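(* The following three operators $$\Re_1=\left(2u_2^{-1}D_x+2D_xu_2^{-1}-u_3u_2^{-3/2}D_x^{-1}u_3u_2^{-3/2}\right)D_x,$$ $$\Re_2=\left(u_1^4u_2^{-2}D_x+D_xu_1^4u_2^{-2}-8u_1D_x^{-1}u_1\right)D_x,$$ $$\Re_3=\left(u_1^{-4}D_x+D_xu_1^{-4}-4(u_3u_1^{-6}-3u_2^2u_1^{-7})D_x^{-1}u_1-4u_1D_x^{-1}(u_3u_1^{-6}-3u_2^2u_1^{-7})\right)D_x$$ are all recursion operators of the nonlocal Hunter-Saxton equation $u_t=2uu_x-D_x^{-1}u_x^2$.
   Context: $u$ is a scalar dependent variable, $u_k=\partial_x^ku$, $D_x=\sum_{k\ge0}u_{k+1}\,\partial/\partial u_k$, and $D_x^{-1}$ is its formal inverse. Operators are formal pseudo-differential operators in $D_x$ with coefficients differential functions (smooth functions of finitely many $u_k$, on a domain where denominators do not vanish and branches of fractional powers are fixed); juxtaposition is composition, functions acting by multiplication. Put $K=2uu_1-D_x^{-1}u_1^2$, so that $D_xK=2uu_2+u_1^2$, and its Fréchet derivative is $D_K=2uD_x+2u_1-2D_x^{-1}u_1D_x$. For an operator $\Re$, $D_\Re[K]$ denotes the operator obtained by differentiating the coefficients of $\Re$ in the direction $K$ (i.e. applying the derivation $\sum_k D_x^kK\,\partial/\partial u_k$ to each coefficient). $\Re$ is a recursion operator of $u_t=K$ if $L_K\Re:=D_\Re[K]-D_K\Re+\Re D_K=0$. *)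

(* Defs.v *)
From HB Require Import structures.
From mathcomp Require Import all_boot all_order all_algebra.
From mathcomp Require Import all_classical all_reals all_analysis.

Set Implicit Arguments.
Unset Strict Implicit.
Unset Printing Implicit Defensive.

Import Order.TTheory GRing.Theory Num.Theory.
Import numFieldNormedType.Exports.
Local Open Scope classical_set_scope.
Local Open Scope ring_scope.

(** * Formal pseudo-differential operators over a ring A with a map D *)

(* The binomial coefficient m(m-1)...(m-k+1)/k! for an integer m;
   for m = -(n+1) it equals (-1)^k 'C(n+k, k). *)
Definition binz (m : int) (k : nat) : int :=
  match m with
  | Posz n => ('C(n, k))%:Z
  | Negz n => (-1) ^+ k * ('C(n + k, k))%:Z
  end.

(* [Pdo N a] is the formal series  \sum_(n >= 0) a_n D^(N - n). Leading
   coefficients may vanish, so a given operator has several representations;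
   operators are to be compared through [coefD]. *)
Record pdo (A : Type) := Pdo { pdo_ord : int; pdo_seq : nat -> A }.

Section Pdo.
Variables (A : comPzRingType) (D : A -> A).
Implicit Types (P Q : pdo A) (a : A).

(* the coefficient of D^m *)
Definition coefD P (m : int) : A :=
  if m <= pdo_ord P then pdo_seq P `|pdo_ord P - m|%N else 0.

Definition mulop a : pdo A := Pdo 0 (fun n => if n == 0%N then a else 0).

Definition powD (m : int) : pdo A :=
  Pdo m (fun n => if n == 0%N then 1 else 0).

Definition addop P Q : pdo A :=
  let N := Num.max (pdo_ord P) (pdo_ord Q) in
  Pdo N (fun n => coefD P (N - n%:Z) + coefD Q (N - n%:Z)).

Definition oppop P : pdo A := Pdo (pdo_ord P) (fun n => - pdo_seq P n).

Definition scaleop (c : int) P : pdo A :=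
  Pdo (pdo_ord P) (fun n => pdo_seq P n *~ c).

(* Composition is determined by the Leibniz rule
   D^m b = \sum_(k >= 0) binz m k . D^k(b) . D^(m - k), for every integer m. *)
Definition compop P Q : pdo A :=
  Pdo (pdo_ord P + pdo_ord Q)
    (fun n => \sum_(i < n.+1) \sum_(j < (n - i).+1)
       let k := (n - i - j)%N in
       pdo_seq P i * iter k D (pdo_seq Q j) *~ binz (pdo_ord P - i%:Z) k).

Definition mapop (d : A -> A) P : pdo A :=
  Pdo (pdo_ord P) (fun n => d (pdo_seq P n)).

End Pdo.

(** * Differential functions *)

(* The scalar field K is any numFieldType, e.g. the real or the complex
   numbers. A point of the jet space assigns a value to every u_k (coordinate
   [Some k]) and to the nonlocal variable w = D_x^{-1} u_1^2 (coordinate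
   [None]); the topology is the product topology. *)
Notation jet K := {ptws option nat -> K}.

Section Jets.
Variable K : numFieldType.
Implicit Types (p q : jet K) (f : jet K -> K) (Omega : set (jet K)).

Definition u (k : nat) : jet K -> K := fun p => p (Some k).
Definition w : jet K -> K := fun p => p None.

Definition recip f : jet K -> K := fun p => (f p)^-1.

Definition line f p (i : option nat) : K -> K :=
  fun t => f (fun j => if j == i then t else p j).

Definition partial (i : option nat) f : jet K -> K :=
  fun p => derive1 (line f p i) (p i).

Definition iter_partial (s : seq (option nat)) f : jet K -> K :=
  foldr partial f s.

(* C^oo on Omega: all iterated partial derivatives exist and are continuous *)
Definition smooth Omega f : Prop :=
  forall (s : seq (option nat)) p, Omega p ->
    {for p, continuous (iter_partial s f)} /\
    forall i, derivable (line (iter_partial s f) p i) (p i) 1.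

(* smooth functions of finitely many of the u_k (and not of w) *)
Definition differential_function Omega f : Prop :=
  smooth Omega f /\
  exists n : nat, forall p q, Omega p -> Omega q ->
    (forall k, (k < n)%N -> u k p = u k q) -> f p = f q.

(* The sum is the finite-support sum. The first term, which vanishes on
   differential functions, expresses D_x w = u_1^2. *)
Definition Dx f : jet K -> K := fun p =>
  u 1 p ^+ 2 * partial None f p
  + \sum_(k \in [set: nat]) u k.+1 p * partial (Some k) f p.

(* The evolutionary derivation \sum_k D_x^k(Q) d/du_k; it is only meant to be
   applied to differential functions f, whereas Q may involve w. *)
Definition evol (Q f : jet K -> K) : jet K -> K := fun p =>
  \sum_(k \in [set: nat]) iter k Dx Q p * partial (Some k) f p.

End Jets.

Declare Scope pdo_scope.
Delimit Scope pdo_scope with pdo.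

Notation "P + Q" := (addop P Q) : pdo_scope.
Notation "- P" := (oppop P) : pdo_scope.
Notation "P - Q" := (addop P (oppop Q)) : pdo_scope.
Notation "P * Q" := (compop (@Dx _) P Q) : pdo_scope.
Notation "c *: P" := (scaleop c%Z P) : pdo_scope.
Notation "f %:O" := (mulop f%R)
  (at level 1, left associativity, format "f %:O") : pdo_scope.

(** * The nonlocal Hunter-Saxton equation *)

Section HunterSaxton.
Variable K : numFieldType.

Definition operator : Type := pdo (jet K -> K).

Bind Scope pdo_scope with operator.

Implicit Types (R : operator) (Omega : set (jet K)).

Notation u := (@u K).
Notation w := (@w K).

(* D_x and D_x^{-1} as operators *)
Definition Dop : operator := powD _ 1.
Definition Dinv : operator := powD _ (-1).

(* the right-hand side 2 u u_1 - D_x^{-1} u_1^2 *)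
Definition HS : jet K -> K := 2 * u 0 * u 1 - w.

Definition frechet_HS : operator :=
  ((2 * u 0)%:O * Dop + (2 * u 1)%:O - 2 *: (Dinv * (u 1)%:O * Dop))%pdo.

Definition Lie_HS R : operator :=
  (mapop (evol HS) R - frechet_HS * R + R * frechet_HS)%pdo.

Definition vanishes_on Omega R : Prop :=
  forall (m : int) p, Omega p -> coefD R m p = 0.

Definition is_pdo Omega R : Prop :=
  forall m : int, differential_function Omega (coefD R m).

Definition recursion_operator Omega R : Prop :=
  is_pdo Omega R /\ vanishes_on Omega (Lie_HS R).

(* s is a branch of u_2^(1/2), so that u_2^(-3/2) is (s^-1)^3 *)
Definition Re1 (s : jet K -> K) : operator :=
  let h := u 3 * recip s ^+ 3 in
  ((2 *: ((recip (u 2))%:O * Dop) + 2 *: (Dop * (recip (u 2))%:O)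
    - h%:O * Dinv * h%:O) * Dop)%pdo.

Definition Re2 : operator :=
  let f := u 1 ^+ 4 * recip (u 2) ^+ 2 in
  ((f%:O * Dop + Dop * f%:O - 8 *: ((u 1)%:O * Dinv * (u 1)%:O)) * Dop)%pdo.

Definition Re3 : operator :=
  let f := recip (u 1) ^+ 4 in
  let g := u 3 * recip (u 1) ^+ 6 - 3 * u 2 ^+ 2 * recip (u 1) ^+ 7 in
  ((f%:O * Dop + Dop * f%:O
    - 4 *: (g%:O * Dinv * (u 1)%:O) - 4 *: ((u 1)%:O * Dinv * g%:O))
   * Dop)%pdo.

End HunterSaxton.

(* Main.v *)
(** Since D_x K = 2 u u_2 + u_1^2 is local, D_K = 2 u D_x + 2 D_x^{-1} u_2. Each
    operator is P D_x with P = a D_x + D_x a + \sum_i g_i D_x^{-1} h_i, and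
    D_x^{-1} (u_2 g_i) =: G_i, D_x^{-1} (u_2 h_i) =: H_i are local. As
    D_x^{-1} G' D_x^{-1} = G D_x^{-1} - D_x^{-1} G, the Lie derivative of P D_x
    collapses to four conditions, with a dot for the derivative along the flow:
    a. = 2 u a' - 4 u_1 a;  g_i. = 2 u g_i' + 2 G_i;  h_i. = 2 u h_i' + 2 H_i;
    2 u_3 a + u_2 a' + \sum_i g_i H_i = 0 = 2 u_3 a + u_2 a' + \sum_i G_i h_i.
    Operators act on series on the left; there D_x is injective, which reduces
    identities involving D_x^{-1} to the Leibniz rule. *)
From HB Require Import structures.
From mathcomp Require Import all_boot all_order all_algebra.
From mathcomp Require Import all_classical all_reals all_analysis.
From mathcomp Require Import ring zify.
Require Import Defs.
Set Implicit Arguments.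
Unset Strict Implicit.
Unset Printing Implicit Defensive.
Import Order.TTheory GRing.Theory Num.Theory.
Import numFieldNormedType.Exports.
Local Open Scope classical_set_scope.
Local Open Scope ring_scope.

(** * Formal series in D and the left action of operators *)

(** The trailing D_x of each operator matters: D_x D_K = 2 (u D_x^2 + u_1 D_x + u_2) is a
    differential operator, so the composition with D_K on the right has no nonlocal terms besides
    those of P. The four conditions are algebraic: they make sense in any commutative ring with
    derivations [D] and [E] and elements [U k] such that [D (U k) = U k.+1] and [E (U 1)] is the
    expected expression. Roots and inverses enter as elements with [s * s = U 2] or [s * t = 1], and
    [ring] modulo one such relation verifies the conditions. The obstacle is to obtain such a ring
    from functions. D_x is additive and satisfies the Leibniz rule only at points where its
    arguments are smooth, coefficients matter on [Omega] only, and the flow of u_0 contains w. The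
    ring therefore consists of functions smooth on [Omega], of finitely many coordinates, possibly
    including w, and extended by zero. A separate check shows that the coefficients of the three
    operators do not depend on w. *)

Lemma binz0 b : binz b 0 = 1.
Proof. by case: b => n /=; rewrite ?bin0 ?expr0 ?mul1r ?bin0. Qed.

(** Pascal's rule, negative upper index included, is what makes left multiplication by D associative
    on series of any order. *)
Lemma binzS b k : binz (b + 1) k.+1 = binz b k.+1 + binz b k.
Proof.
case: b => [n|[|n]].
- by rewrite -PoszD addn1 /= binS PoszD.
- have -> : Negz 0 + 1 = 0 by [].
  by rewrite /= !add0n !binn bin0n /= exprS !mulr1 mulN1r addNr.
- have -> : Negz n.+1 + 1 = Negz n by rewrite !NegzE; lia.
  rewrite /= [in RHS]addnS binS -addSnnS PoszD exprS.
  by rewrite mulrDr mulN1r; ring.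
Qed.

Lemma sum_ord_trunc (V : nmodType) (n n' : nat) (F : nat -> V) : (n <= n')%N ->
  (forall i, (n <= i)%N -> F i = 0) -> \sum_(i < n') F i = \sum_(i < n) F i.
Proof.
move=> le_nn' F0; rewrite (big_ord_widen _ F le_nn').
rewrite [RHS]big_mkcond /=; apply: eq_bigr => i _.
by case: ltnP => // /F0.
Qed.

(** * Coefficients of sums and compositions *)

Section Coefficients.
Variables (A : comPzRingType) (D : {additive A -> A}).
Implicit Types (P Q R : pdo A) (a f : A).

Lemma iterD0 k : iter k D 0 = 0.
Proof. by elim: k => //= k ->; rewrite raddf0. Qed.

Lemma iterDD k : {morph iter k D : x y / x + y}.
Proof. by move=> x y; elim: k => //= k ->; rewrite raddfD. Qed.

Lemma coefD_gt P m : pdo_ord P < m -> coefD P m = 0.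
Proof. by rewrite /coefD ltNge => /negbTE ->. Qed.

Lemma coefD_seq P (i : nat) : coefD P (pdo_ord P - i%:Z) = pdo_seq P i.
Proof.
rewrite /coefD ifT; last by lia.
by congr pdo_seq; lia.
Qed.

Lemma coefD_add P Q m : coefD (addop P Q) m = coefD P m + coefD Q m.
Proof.
rewrite {1}/coefD /addop /=; case: ifP => [le_m|/negbT].
  by congr (coefD P _ + coefD Q _); lia.
by rewrite -ltNge gt_max => /andP[? ?]; rewrite !coefD_gt ?addr0.
Qed.

Lemma coefD_opp P m : coefD (oppop P) m = - coefD P m.
Proof. by rewrite /coefD /=; case: ifP; rewrite ?oppr0. Qed.

Lemma coefD_scale c P m : coefD (scaleop c P) m = coefD P m *~ c.
Proof. by rewrite /coefD /=; case: ifP; rewrite ?mul0rz. Qed.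

Lemma coefD_map (d : A -> A) P m : d 0 = 0 ->
  coefD (mapop d P) m = d (coefD P m).
Proof. by move=> d0; rewrite /coefD /=; case: ifP; rewrite ?d0. Qed.

Lemma coefD_mulop f m : coefD (mulop f) m = if m == 0 then f else 0.
Proof.
rewrite /coefD /=; case: ifP => m0; last by case: eqP m0 => // ->.
by rewrite absz_eq0 sub0r oppr_eq0.
Qed.

Lemma coefD_powD n m : coefD (powD A n) m = (m == n)%:R.
Proof.
rewrite /coefD /=; case: ifP => mn; last by case: eqP mn => // ->; rewrite lexx.
by rewrite absz_eq0 subr_eq0 eq_sym; case: eqP.
Qed.

(* The summation range is left free: any [N >= pdo_ord P] and any large [n]
   will do, which spares the reindexing when orders do not match. *)
Lemma coefD_comp P Q (N : int) (n : nat) (m : int) :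
    pdo_ord P <= N -> N + pdo_ord Q - m < n%:Z ->
  coefD (compop D P Q) m = \sum_(i < n) \sum_(k < n)
    coefD P (N - i%:Z) * iter k D (coefD Q (m - N + i%:Z + k%:Z))
      *~ binz (N - i%:Z) k.
Proof.
move=> PN Nn.
(* Raising the order of [P] to [N] prepends [d] zero coefficients. Once they are removed, [k] plays
   the part of n - i - j in [compop], hence the reversal of the inner sum below. *)
have [d Nd] : exists d : nat, N = pdo_ord P + d%:Z.
  by exists `|N - pdo_ord P|%N; lia.
have P0 (i : nat) : (i < d)%N -> coefD P (N - i%:Z) = 0.
  by move=> ?; apply: coefD_gt; lia.
pose F (i k : nat) := coefD P (N - i%:Z) *
  iter k D (coefD Q (m - N + i%:Z + k%:Z)) *~ binz (N - i%:Z) k.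
have F0 (i k : nat) : N + pdo_ord Q - m < (i + k)%:Z -> F i k = 0.
  by move=> ik; rewrite /F (coefD_gt (P := Q)) ?iterD0 ?mulr0 ?mul0rz//; lia.
rewrite -[RHS]/(\sum_(i < n) \sum_(k < n) F i k).
case: (leP m (pdo_ord P + pdo_ord Q)) => [le_m|gt_m]; last first.
  rewrite coefD_gt//= big1// => i _; rewrite big1// => k _.
  case: (ltnP i d) => [/P0|] id; first by rewrite /F id mul0r mul0rz.
  by apply: F0; lia.
have [nn nnE] : exists nn : nat, (pdo_ord P + pdo_ord Q)%R = m + nn%:Z :> int.
  by exists `|(pdo_ord P + pdo_ord Q - m)%R|%N; lia.
have lt_nn : (d + nn < n)%N by lia.
rewrite -(big_mkord xpredT (fun i => \sum_(k < n) F i k)).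
rewrite (big_cat_nat _ (n := d))//=; last by lia.
rewrite big_nat big1 ?add0r; last first.
  move=> i /andP[_ id]; rewrite big1// => k _.
  by rewrite /F P0// mul0r mul0rz.
rewrite -{1}[d]add0n big_addn big_mkord
  (@sum_ord_trunc _ nn.+1 _ (fun i => \sum_(k < n) F (i + d)%N k)); last first.
- by move=> i ni; rewrite big1// => k _; apply: F0; lia.
- by lia.
rewrite /coefD /compop /= le_m.
rewrite (_ : `|_|%N = nn); last by lia.
apply: eq_bigr => i _; rewrite (@sum_ord_trunc _ (nn - i).+1 _ (F (i + d)%N));
  first last.
- by move=> k nk; apply: F0; have := ltn_ord i; lia.
- by have := ltn_ord i; lia.
rewrite [RHS](reindex_inj rev_ord_inj)/=; apply: eq_bigr => j _.
have ltj := ltn_ord j; have lti := ltn_ord i.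
rewrite /F Nd (_ : pdo_ord P + d%:Z - (i + d)%N%:Z = pdo_ord P - i%:Z);
  last by lia.
rewrite subSS coefD_seq; congr (_ * iter _ _ _ *~ _).
by rewrite -coefD_seq; congr coefD; lia.
Qed.

End Coefficients.

(** Laurent series in D^-1, as coefficient families on all integers: unlike [pdo], each series has
    one representation, so Leibniz equality is usable. Values lie in [A^o], [A] as a module over
    itself, so that the module structure comes by subtyping. *)
Definition bounded_above (A : pzRingType) : {pred int -> A^o} :=
  [pred c | `[< exists N : int, forall m, N < m -> c m = 0 >]].

Fact bounded_above_submod (A : pzRingType) :
  GRing.submod_closed (@bounded_above A).
Proof.
split=> [|a x y /asboolP[N Nx] /asboolP[N' Ny]].
  by apply/asboolP; exists 0.
apply/asboolP; exists (Num.max N N') => m; rewrite gt_max => /andP[? ?].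
by rewrite !fctE Nx// Ny// scaler0 addr0.
Qed.
HB.instance Definition _ (A : pzRingType) :=
  GRing.isSubmodClosed.Build A (int -> A^o) (@bounded_above A)
    (bounded_above_submod A).

Record ser (A : pzRingType) :=
  Ser { cf :> int -> A^o; cfP : cf \in @bounded_above A }.
HB.instance Definition _ A := [isSub for @cf A].
HB.instance Definition _ (A : pzRingType) := [Choice of ser A by <:].
HB.instance Definition _ (A : pzRingType) :=
  [SubChoice_isSubLmodule of ser A by <:].

Section Ser.
Variable A : comPzRingType.
Implicit Types (x y : ser A) (f : A) (m : int).

Lemma serP x y : (forall m, x m = y m) -> x = y.
Proof. by move=> xy; apply: val_inj; apply/funext. Qed.

Lemma cf0 m : (0 : ser A) m = 0. Proof. by []. Qed.
Lemma cfD x y m : (x + y) m = x m + y m. Proof. by []. Qed.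
Lemma cfN x m : (- x) m = - x m. Proof. by []. Qed.
Lemma cfZ f x m : (f *: x) m = f * x m. Proof. by []. Qed.
Lemma cfMn x (n : nat) m : (x *+ n) m = x m *+ n.
Proof. by elim: n => // n IH; rewrite !mulrS cfD IH. Qed.
Lemma cfMz x (n : int) m : (x *~ n) m = x m *~ n.
Proof. by case: n => n; rewrite ?NegzE ?mulrNz ?cfN -!pmulrn cfMn. Qed.
End Ser.

(** * Left action of operators on series, and associativity *)

Section Action.
Variables (A : comPzRingType) (D : {additive A -> A}).
Hypothesis DM : forall x y, D (x * y) = D x * y + x * D y.
Implicit Types (P Q : pdo A) (x y : ser A) (f : A) (m : int).

Lemma D1 : D 1 = 0.
Proof.
have := DM 1 1; rewrite !mulr1 mul1r => /eqP.
by rewrite -subr_eq0 opprD addNKr oppr_eq0 => /eqP.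
Qed.

Fact coefD_bounded P : coefD P \in @bounded_above A.
Proof. by apply/asboolP; exists (pdo_ord P) => m; apply: coefD_gt. Qed.
Definition cls P : ser A := Ser (coefD_bounded P).

Lemma clsE P m : cls P m = coefD P m. Proof. by []. Qed.

Lemma ser_bounded x : exists N : int, forall m, N < m -> x m = 0.
Proof. by case: x => c /= /asboolP. Qed.

Definition ser_ord x : int := projT1 (cid (ser_bounded x)).
Lemma ser_gt x m : ser_ord x < m -> x m = 0.
Proof. exact: (projT2 (cid (ser_bounded x))). Qed.

Definition ser_pdo x : pdo A := Pdo (ser_ord x) (fun n => x (ser_ord x - n%:Z)).

Lemma ser_pdoK : cancel ser_pdo cls.
Proof.
move=> x; apply: serP => m; rewrite clsE /coefD /=; case: ifPn => [le_m|].
  by congr (x _); lia.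
by rewrite -ltNge => /ser_gt.
Qed.

(** The representative [ser_pdo x] has an order obtained by choice; [act_cls] and [act_ext] show
    that only coefficients of either factor matter. *)
Definition act P x : ser A := cls (compop D P (ser_pdo x)).

Lemma actE P x (N : int) (n : nat) m :
    pdo_ord P <= N -> N + ser_ord x - m < n%:Z ->
  act P x m = \sum_(i < n) \sum_(k < n) coefD P (N - i%:Z) *
    iter k D (x (m - N + i%:Z + k%:Z)) *~ binz (N - i%:Z) k.
Proof.
move=> PN Nn; rewrite clsE (@coefD_comp _ D P (ser_pdo x) N n m PN Nn).
apply: eq_bigr => i _; apply: eq_bigr => k _.
by rewrite -(clsE (ser_pdo x)) ser_pdoK.
Qed.

Lemma act_cls P Q : act P (cls Q) = cls (compop D P Q).
Proof.
apply: serP => m; rewrite !clsE.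
pose N := pdo_ord P; pose n := `|(N + ser_ord (cls Q) - m)%R|%N.+1.
pose n' := `|(N + pdo_ord Q - m)%R|%N.+1.
rewrite (@coefD_comp _ _ _ _ N (maxn n n')) ?(@coefD_comp _ _ _ _ N (maxn n
  n')) //.
  apply: eq_bigr => i _; apply: eq_bigr => k _.
  by rewrite -(clsE (ser_pdo _)) ser_pdoK.
all: rewrite /n /n'/=; lia.
Qed.

Lemma act_ext P P' : (forall m, coefD P m = coefD P' m) -> act P =1 act P'.
Proof.
move=> PP' x; apply: serP => m.
pose N := Num.max (pdo_ord P) (pdo_ord P').
have Nn : N + ser_ord x - m < `|(N + ser_ord x - m)%R|%N.+1%:Z by lia.
rewrite !(@actE _ _ N _ _ _ Nn) ?le_max ?lexx ?orbT//.
by apply: eq_bigr => i _; apply: eq_bigr => k _; rewrite PP'.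
Qed.

Lemma act_addop P P' x : act (addop P P') x = act P x + act P' x.
Proof.
apply: serP => m; rewrite cfD.
pose N := Num.max (pdo_ord P) (pdo_ord P').
have Nn : N + ser_ord x - m < `|(N + ser_ord x - m)%R|%N.+1%:Z by lia.
rewrite !(@actE _ _ N _ _ _ Nn) /= ?lexx ?le_max ?lexx ?orbT//.
rewrite -big_split; apply: eq_bigr => i _; rewrite -big_split;
  apply: eq_bigr => k _.
by rewrite coefD_add mulrDl mulrzDl.
Qed.

Lemma act_oppop P x : act (oppop P) x = - act P x.
Proof.
apply: serP => m; rewrite cfN.
pose N := pdo_ord P.
have Nn : N + ser_ord x - m < `|(N + ser_ord x - m)%R|%N.+1%:Z by lia.
rewrite !(@actE _ _ N _ _ _ Nn)//.
rewrite -sumrN; apply: eq_bigr => i _; rewrite -sumrN; apply: eq_bigr => k _.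
by rewrite coefD_opp mulNr mulNrz.
Qed.

Lemma act_scaleop c P x : act (scaleop c P) x = act P x *~ c.
Proof.
apply: serP => m; rewrite cfMz.
pose N := pdo_ord P.
have Nn : N + ser_ord x - m < `|(N + ser_ord x - m)%R|%N.+1%:Z by lia.
rewrite !(@actE _ _ N _ _ _ Nn)//.
rewrite mulrz_suml; apply: eq_bigr => i _; rewrite mulrz_suml;
  apply: eq_bigr => k _.
by rewrite coefD_scale mulrzAl -!mulrzA [c * _]mulrC.
Qed.

Lemma actD P : {morph act P : x y / x + y}.
Proof.
move=> x y; apply: serP => m; rewrite cfD.
(* [ser_ord] is some bound given by choice, so [ser_ord (x + y)] is not controlled by the other two
   and has to join the maximum. *)
pose N := pdo_ord P; pose M := Num.max (ser_ord x) (Num.max (ser_ord y)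
  (ser_ord (x + y))).
pose n := `|(N + M - m)%R|%N.+1.
rewrite !(@actE _ _ N n)//; try by rewrite /n /M; lia.
rewrite -big_split; apply: eq_bigr => i _; rewrite -big_split;
  apply: eq_bigr => k _.
by rewrite cfD iterDD mulrDr mulrzDl.
Qed.

Lemma act0 P : act P 0 = 0.
Proof. by apply/(addrI (act P 0)); rewrite -actD !addr0. Qed.
HB.instance Definition _ P := GRing.isNmodMorphism.Build (ser A) (ser A) (act P)
  (conj (act0 P) (actD P)).

Lemma act_mulop f x : act (mulop f) x = f *: x.
Proof.
apply: serP => m; rewrite cfZ (@actE _ _ 0 `|(ser_ord x - m)%R|%N.+1)//;
  last by lia.
rewrite big_ord_recl /= [X in _ + X]big1 ?addr0 => [|i _]; last first.
  by rewrite big1// => k _; rewrite coefD_mulop mul0r mul0rz.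
rewrite big_ord_recl /= [X in _ + X]big1 ?addr0 => [|i _].
  by rewrite coefD_mulop.
by rewrite mulr0z.
Qed.

Definition deriv := act (powD A 1).
Definition prim := act (powD A (-1)).

Lemma derivE x m : deriv x m = x (m - 1) + D (x m).
Proof.
rewrite /deriv (@actE _ _ 1 `|(ser_ord x - m)%R|%N.+2)//; last by lia.
rewrite big_ord_recl /= [X in _ + X]big1 ?addr0 => [|i _]; last first.
  by rewrite big1// => k _;
    rewrite coefD_powD (_ : _ == _ = false) ?mul0r ?mul0rz//; rewrite /bump/=;
      lia.
rewrite 2!big_ord_recl /= [X in _ + (_ + X)]big1 ?addr0 => [|i _].
  rewrite coefD_powD/= !mul1r /bump/=. congr (x _ + D (x _)); lia.
by rewrite mulr0z.
Qed.

HB.instance Definition _ := GRing.Additive.copy deriv (act (powD A 1)).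
HB.instance Definition _ := GRing.Additive.copy prim (act (powD A (-1))).

Lemma derivZ f x : deriv (f *: x) = D f *: x + f *: deriv x.
Proof. by apply: serP => m; rewrite derivE cfD !cfZ derivE DM; ring. Qed.

(** [deriv x = 0] reads x_(m-1) = - D(x_m), so vanishing propagates downwards from the bound on the
    order. No injectivity of [D] on [A] is involved. *)
Lemma deriv_inj : injective deriv.
Proof.
suff der0 x : deriv x = 0 -> x = 0.
  move=> x y xy; apply/eqP; rewrite -subr_eq0; apply/eqP/der0/serP => m.
  have /(congr1 (fun z : ser A => z m)) := xy.
  by rewrite !derivE !cfD !cfN cf0 raddfB; move/eqP;
    rewrite -subr_eq0 => /eqP <-; ring.
move=> dx; apply: serP => m; rewrite cf0.
suff x0 k : x (ser_ord x + 1 - k%:Z) = 0.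
  have [|le_m] := ltP (ser_ord x) m; first exact: ser_gt.
  by rewrite -(x0 `|(ser_ord x + 1 - m)%R|%N); congr (x _); lia.
elim: k => [|k IH]; first by apply: ser_gt; lia.
have := congr1 (fun z : ser A => z (ser_ord x + 1 - k%:Z)) dx.
rewrite derivE IH raddf0 addr0 cf0 => <-; congr (x _); lia.
Qed.

(* Associativity is needed, and proved, only for left factors built from
   functions, D and D^-1: the operators satisfying [assocl] are closed under
   sums and products, which avoids the Vandermonde identity for [binz]. *)
Definition assocl P := forall Q x, act (compop D P Q) x = act P (act Q x).

Lemma assocl_mulop f : assocl (mulop f).
Proof.
move=> Q x; rewrite act_mulop; apply: serP => m; rewrite cfZ.
pose N := pdo_ord Q.
have Nn : N + ser_ord x - m < `|(N + ser_ord x - m)%R|%N.+1%:Z by lia.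
rewrite !(@actE _ _ N _ _ _ Nn)//= ?add0r//.
rewrite big_distrr; apply: eq_bigr => i _; rewrite big_distrr;
  apply: eq_bigr => k _.
rewrite -clsE -act_cls act_mulop cfZ clsE /= -mulrA.
by rewrite mulrzAr.
Qed.

Lemma assocl_D : assocl (powD A 1).
Proof.
(* [SQ] is Q D: the composite D Q splits as Q D + D(Q), where the second term differentiates the
   coefficients. *)
move=> Q x; pose SQ := Pdo (pdo_ord Q + 1) (pdo_seq Q).
have coefSQ m : coefD SQ m = coefD Q (m - 1).
  by rewrite /coefD /= lerBlDr; congr (if _ then pdo_seq _ _ else _); lia.
have SQE m : coefD (compop D (powD A 1) Q) m = coefD (addop SQ (mapop D Q)) m.
  rewrite -clsE -act_cls -/(deriv _) derivE !clsE coefD_add coefSQ.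
  by rewrite coefD_map ?raddf0.
rewrite (act_ext SQE) act_addop -/(deriv _); apply: serP => m;
  rewrite derivE cfD.
pose M := pdo_ord Q; pose n := `|(M + ser_ord x - m)%R|%N.+2.
rewrite (@actE SQ _ (M + 1) n)//; last by rewrite /n; lia.
rewrite !(@actE _ _ M n)//; try by rewrite /n; lia.
rewrite raddf_sum -!big_split; apply: eq_bigr => i _ /=.
rewrite raddf_sum /=.
set q := coefD Q (M - i%:Z); pose b := M - i%:Z; pose c := m - M + i%:Z.
pose F (k : nat) := q * iter k D (x (c - 1 + k%:Z)).
(* Shifting k in the second half of Pascal's rule leaves one boundary term, at the last index; [n]
   is large enough for it to vanish. *)
have pascal : \sum_(k < n) F k *~ binz (b + 1) k = \sum_(k < n) F k *~ binz b k
    + \sum_(k < n) q * D (iter k D (x (c + k%:Z))) *~ binz b k.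
  rewrite [LHS]big_ord_recl [X in _ = X + _]big_ord_recl.
  rewrite [X in _ = _ + X]big_ord_recr /= !binz0 (ser_gt (x := x)); last first.
    by rewrite /c; lia.
  rewrite iterD0 !raddf0 mulr0 mul0rz addr0 -[RHS]addrA -big_split /=;
    congr (_ + _).
  apply: eq_bigr => k _; rewrite /bump /= binzS mulrzDr /F /=.
  by congr (_ + q * D (iter _ _ (x _)) *~ _); lia.
transitivity (\sum_(k < n) F k *~ binz (b + 1) k +
    \sum_(k < n) D q * iter k D (x (c + k%:Z)) *~ binz b k).
  congr (_ + _); apply: eq_bigr => k _; last by rewrite coefD_map ?raddf0.
  rewrite coefSQ; congr (coefD Q _ * iter _ _ (x _) *~ binz _ _);
    rewrite /b /c; lia.
rewrite pascal -[LHS]addrA -big_split /=; congr (_ + _); apply: eq_bigr => k _.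
  by congr (_ * iter _ _ (x _) *~ _); rewrite /c; lia.
by rewrite raddfMz DM mulrzDl addrC.
Qed.

Lemma act_one x : act (mulop 1) x = x.
Proof. by rewrite act_mulop scale1r. Qed.

Lemma primK : cancel prim deriv.
Proof.
move=> x; rewrite -[LHS]assocl_D -[RHS]act_one; apply: act_ext => m.
rewrite -clsE -act_cls -/(deriv _) derivE !clsE !coefD_powD.
have -> : D (m == -1)%:R = 0 by case: (m == _); rewrite ?raddf0 ?D1.
by rewrite addr0 (_ : (m - 1 == -1) = (m == 0)) //; lia.
Qed.

Lemma cls_ext P P' : cls P = cls P' -> act P =1 act P'.
Proof. by move=> PP'; apply: act_ext => m; rewrite -!clsE PP'. Qed.

(** Injectivity of [deriv] allows D to be applied to both sides; associativity for D and [primK]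
    then leave the action of [Q] on each. *)
Lemma assocl_Dinv : assocl (powD A (-1)).
Proof.
move=> Q x; apply: deriv_inj; rewrite [RHS]primK -[LHS]assocl_D.
by apply: cls_ext; rewrite -!act_cls [LHS]primK.
Qed.

Lemma assocl_addop P P' : assocl P -> assocl P' -> assocl (addop P P').
Proof.
move=> aP aP' Q x; rewrite act_addop -aP -aP' -act_addop; apply: cls_ext.
apply: serP => m; rewrite [RHS]clsE coefD_add -!clsE -!act_cls.
by rewrite act_addop cfD.
Qed.

Lemma assocl_oppop P : assocl P -> assocl (oppop P).
Proof.
move=> aP Q x; rewrite act_oppop -aP -act_oppop; apply: cls_ext.
apply: serP => m; rewrite [RHS]clsE coefD_opp -!clsE -!act_cls.
by rewrite act_oppop cfN.
Qed.

Lemma assocl_scaleop c P : assocl P -> assocl (scaleop c P).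
Proof.
move=> aP Q x; rewrite act_scaleop -aP -act_scaleop; apply: cls_ext.
apply: serP => m; rewrite [RHS]clsE coefD_scale -!clsE -!act_cls.
by rewrite act_scaleop cfMz.
Qed.

Lemma assocl_compop P P' : assocl P -> assocl P' -> assocl (compop D P P').
Proof.
move=> aP aP' Q x; rewrite aP -aP' -aP; apply: cls_ext.
by rewrite -!act_cls aP.
Qed.

Section Derivation.
Variable E : {additive A -> A}.
Hypothesis EM : forall f g, E (f * g) = E f * g + f * E g.

Fact map_bounded x : (fun m => E (x m)) \in @bounded_above A.
Proof.
by apply/asboolP; exists (ser_ord x) => m /ser_gt ->; rewrite raddf0.
Qed.
Definition mapser x : ser A := Ser (map_bounded x).

Lemma cls_map P : cls (mapop E P) = mapser (cls P).
Proof. by apply: serP => m; rewrite clsE coefD_map ?raddf0. Qed.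

(** In a composition [D] hits only the coefficients of the right factor, so commutation with [E] is
    asked of [x] alone. *)
Lemma mapser_act P x :
    (forall m k, E (iter k D (x m)) = iter k D (E (x m))) ->
  mapser (act P x) = act (mapop E P) x + act P (mapser x).
Proof.
move=> xE; apply: serP => m; rewrite cfD -[LHS]/(E (act P x m)).
pose N := pdo_ord P; pose M := Num.max (ser_ord x) (ser_ord (mapser x)).
pose n := `|(N + M - m)%R|%N.+1.
rewrite !(@actE _ _ N n)//; try by rewrite /n /M; lia.
rewrite raddf_sum -big_split; apply: eq_bigr => i _ /=.
rewrite raddf_sum -big_split; apply: eq_bigr => k _ /=.
by rewrite raddfMz EM coefD_map ?raddf0// xE mulrzDl.
Qed.
End Derivation.
End Action.

(** * The Lie derivative along the Hunter-Saxton flow *)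

Section Commutation.
Variables (A : comPzRingType) (D E : {additive A -> A}).
Hypothesis DM : forall f g, D (f * g) = D f * g + f * D g.
Hypothesis EM : forall f g, E (f * g) = E f * g + f * E g.
Implicit Types (P Q R : pdo A) (f g x t : A).

(* [E] stands for the evolutionary derivation. Over an arbitrary numFieldType
   partial derivatives need not commute, so [DE] cannot be expected to vanish
   on all differential functions; being a derivation that kills the u_k, k > 0,
   it vanishes on everything obtained from them by ring operations, inverses
   and square roots. *)
Definition DE f := E (D f) - D (E f).

(** Counting the depth makes inverses and roots tractable by induction: D (x^-1) = - x^-2 D x and 2
    D s = s^-1 D (s^2) express depth n + 1 through the same element at depth n. *)
Fixpoint commDE n f := DE f = 0 /\ if n is n'.+1 then commDE n' (D f) else True.

Lemma commDE_W n f : commDE n.+1 f -> commDE n f.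
Proof.
elim: n f => [|n IH] f [? ?]; first by split.
by split=> //; apply: IH.
Qed.

Lemma DE_B : {morph DE : f g / f - g}.
Proof. move=> f g /=; rewrite /DE !(raddfB D, raddfB E); ring. Qed.

(** A commutator of two derivations is a derivation. *)
Lemma DE_M f g : DE (f * g) = DE f * g + f * DE g.
Proof. by rewrite /DE !(DM, EM, raddfD D, raddfD E); ring. Qed.

Lemma commDE_B n f g : commDE n f -> commDE n g -> commDE n (f - g).
Proof.
elim: n f g => [|n IH] f g [f0 fn] [g0 gn].
  by split=> //; rewrite DE_B f0 g0 subr0.
by split; [rewrite DE_B f0 g0 subr0|rewrite (raddfB D); apply: IH].
Qed.

Lemma commDE0 n : commDE n 0.
Proof.
have DE0 : DE 0 = 0 by rewrite /DE !(raddf0 D, raddf0 E) subr0.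
by elim: n => [|n IH]; split=> //; rewrite raddf0.
Qed.

Lemma commDE_N n f : commDE n f -> commDE n (- f).
Proof. by move=> nf; rewrite -sub0r; apply: commDE_B => //; apply: commDE0. Qed.

Lemma commDE_D n f g : commDE n f -> commDE n g -> commDE n (f + g).
Proof. by move=> nf ng; rewrite -[g]opprK; apply/commDE_B/commDE_N. Qed.

Lemma commDE_Mn n f k : commDE n f -> commDE n (f *+ k).
Proof.
move=> nf; elim: k => [|k IH]; first exact: commDE0.
by rewrite mulrS; apply: commDE_D.
Qed.

Lemma commDE_M n f g : commDE n f -> commDE n g -> commDE n (f * g).
Proof.
elim: n f g => [|n IH] f g nf ng.
  by split=> //; rewrite DE_M nf.1 ng.1 mul0r mulr0 addr0.
split; first by rewrite DE_M nf.1 ng.1 mul0r mulr0 addr0.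
rewrite DM; apply: commDE_D.
  by apply: IH; [exact: nf.2|exact: commDE_W].
by apply: IH; [exact: commDE_W|exact: ng.2].
Qed.

Lemma commDE_X n f k : commDE n f -> commDE n (f ^+ k.+1).
Proof. by move=> nf; elim: k => // k IH; rewrite exprS; apply: commDE_M. Qed.

Lemma DE_inv x t : x * t = 1 -> DE x = 0 -> DE t = 0.
Proof.
move=> xt x0; have := DE_M x t; rewrite x0 mul0r add0r xt.
have -> : DE 1 = 0 by rewrite /DE (D1 DM) (D1 EM) (raddf0 D) (raddf0 E) subr0.
by move/(congr1 ( *%R t)); rewrite mulr0 mulrA [t * x]mulrC xt mul1r.
Qed.

Lemma derivation_inv (d : {additive A -> A}) x t :
    (forall f g, d (f * g) = d f * g + f * d g) ->
  x * t = 1 -> d t = - (t * t * d x).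
Proof.
move=> dM xt; have := dM x t; rewrite xt (D1 dM) => /(congr1 ( *%R t)).
rewrite mulr0 mulrDr !mulrA [t * x]mulrC xt mul1r => /eqP.
by rewrite eq_sym addr_eq0 => /eqP dt; rewrite -[LHS]opprK -dt; congr (- _);
  ring.
Qed.

Lemma commDE_inv n x t : x * t = 1 -> commDE n x -> commDE n t.
Proof.
move=> xt; elim: n => [|n IH] nx; split; rewrite ?(DE_inv xt nx.1)//.
rewrite (derivation_inv DM xt); apply/commDE_N/commDE_M; last exact: nx.2.
by have nt := IH (commDE_W nx); apply: commDE_M.
Qed.

Lemma commDE_iter f : (forall n, commDE n f) ->
  forall k, E (iter k D f) = iter k D (E f).
Proof.
have DE_iter k g : commDE k g -> DE (iter k D g) = 0.
  by elim: k g => [|k IH] g [? ?] //; rewrite iterSr; apply: IH.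
move=> cf; elim=> //= k <-; apply/eqP; rewrite -subr_eq0.
by have /eqP := DE_iter _ _ (cf k).
Qed.

Hypothesis torsion2 : forall f, f *+ 2 = 0 -> f = 0.

Lemma commDE_Mn2 n f : commDE n (f *+ 2) -> commDE n f.
Proof.
have DE2 g : DE (g *+ 2) = 0 -> DE g = 0.
  move=> g0; apply: torsion2; rewrite -g0 /DE !(raddfMn D, raddfMn E); ring.
elim: n f => [|n IH] f [f0 fn]; split; rewrite ?(DE2 _ f0) //.
by apply: IH; rewrite -(raddfMn D).
Qed.

Lemma commDE_sqrt n x s t : s * s = x -> s * t = 1 ->
  (forall n, commDE n x) -> commDE n s.
Proof.
move=> ss st cx.
have s0 : DE s = 0.
  have := DE_M s s; rewrite ss (cx 0).1 => e; apply: torsion2.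
  by rewrite -[_ *+ 2]mul1r -st -(mulr0 t) e; ring.
elim: n => [|n IH]; split=> //; apply: commDE_Mn2.
have -> : D s *+ 2 = D x * t.
  by rewrite -ss DM -[LHS]mulr1 -st; ring.
apply: commDE_M; first exact: (cx n.+1).2.
exact: commDE_inv st IH.
Qed.

End Commutation.

(** * The algebraic identity behind the four conditions *)

Section LieIdentity.
Variables (A : comPzRingType) (D E : {additive A -> A}).
Hypothesis DM : forall f g, D (f * g) = D f * g + f * D g.
Hypothesis EM : forall f g, E (f * g) = E f * g + f * E g.
Variable U : nat -> A.
Hypothesis DU : forall k, D (U k) = U k.+1.

Definition evolves (f : A) := forall k, E (iter k D f) = iter k D (E f).

(* The term g D_x^{-1} h of an operator P such that P D_x is a recursion
   operator. *)
Record nonlocal_pair (g h G H : A) : Prop := NonlocalPair {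
  nonlocal_DG : D G = U 2 * g;
  nonlocal_DH : D H = U 2 * h;
  nonlocal_Eg : E g = (U 0 * D g + G) *+ 2;
  nonlocal_Eh : E h = (U 0 * D h + H) *+ 2;
  nonlocal_ev : evolves h }.

Lemma evolves0 : evolves 0.
Proof. by move=> k; rewrite (raddf0 E) iterD0 raddf0. Qed.

Lemma evolves1 : evolves 1.
Proof. by case=> // k; rewrite iterSr (D1 DM) iterD0 (D1 EM) raddf0 iterD0. Qed.

Lemma nonlocal_pair0 : nonlocal_pair 0 0 0 0.
Proof.
split; rewrite ?(raddf0 D) ?(raddf0 E) ?mulr0 ?addr0 ?mul0rn//.
exact: evolves0.
Qed.

(* [d] and [p] model the actions of D_x and its inverse on series, [eps] the
   evolutionary derivation of their coefficients, and [ev] the coefficients. *)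
Variables (M : lmodType A) (T : Type) (ev : T -> M -> A).
Hypothesis ev_inj : forall x y, (forall m, ev m x = ev m y) -> x = y.
Hypothesis evD : forall m x y, ev m (x + y) = ev m x + ev m y.
Hypothesis evZ : forall m f x, ev m (f *: x) = f * ev m x.
Variables (d p : {additive M -> M}) (eps : M -> M).
Hypothesis dZ : forall f x, d (f *: x) = D f *: x + f *: d x.
Hypothesis pK : cancel p d.
Hypothesis d_inj : injective d.
Hypothesis epsD : {morph eps : x y / x + y}.
Hypothesis epsZ : forall f x, eps (f *: x) = E f *: x + f *: eps x.
Variable y : M.
Hypothesis epsy : eps y = 0.
Hypothesis eps_d : forall f, evolves f -> eps (d (f *: y)) = d (eps (f *: y)).
Hypothesis eps_p : forall f, evolves f -> eps (p (f *: y)) = p (eps (f *: y)).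
Implicit Types (x : M) (m : T) (f g h a : A).

Local Lemma evMn m x n : ev m (x *+ n) = ev m x *+ n.
Proof. by rewrite -scaler_nat evZ mulr_natl. Qed.
Local Lemma evN m x : ev m (- x) = - ev m x.
Proof. by rewrite -scaleN1r evZ mulN1r. Qed.
Local Lemma evMz m x n : ev m (x *~ n) = ev m x *~ n.
Proof. by case: n => n; rewrite ?NegzE ?mulrNz ?evN -!pmulrn evMn. Qed.
(** Taking coefficients turns an identity in the module [M] into one in the commutative ring [A],
    where [ring] applies. *)
Local Definition evE := (evD, evZ, evN, evMn, evMz).

Definition frechet_act x :=
  (2 * U 0) *: d x + (2 * U 1) *: x - p (U 1 *: d x) *~ 2.

Lemma frechet_actE x : frechet_act x = (U 0 *: d x + p (U 2 *: x)) *+ 2.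
Proof.
rewrite /frechet_act (_ : p (U 1 *: d x) = U 1 *: x - p (U 2 *: x)).
  by apply: ev_inj => m; rewrite !evE -!pmulrn; ring.
apply: d_inj; rewrite (raddfB d) !pK dZ DU.
by rewrite addrAC subrr add0r.
Qed.

Local Notation nonlocal g h x := (g *: p (h *: x)).

(** Integration by parts. The remaining integrand carries the factor [U 0 * D h + H], half of [E h],
    so it will cancel against the derivative of [h] along the flow in [eps_nonlocal]. *)
Lemma nonlocal_frechet g h G H x : nonlocal_pair g h G H ->
  p (h *: (U 0 *: d (d x) + U 1 *: d x + U 2 *: x)) =
  (h * U 0) *: d x + H *: x - p ((U 0 * D h + H) *: d x).
Proof.
case=> _ DH _ _ _; apply: d_inj.
rewrite (raddfB d) (raddfD d) !dZ !pK DH DM DU.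
by apply: ev_inj => m; rewrite !evE; ring.
Qed.

Lemma eps_nonlocal g h G H : nonlocal_pair g h G H ->
  eps (nonlocal g h y) =
  nonlocal (E g) h y + g *: p ((U 0 * D h + H) *: y) *+ 2.
Proof.
case=> _ _ _ Eh evh; rewrite epsZ; congr (_ + _).
by rewrite eps_p// epsZ epsy scaler0 addr0 Eh scalerMnr -raddfMn scalerMnl.
Qed.

(* In the application [x] is the operator 1, so [y] is D_x and [P y] the
  operator
   P D_x. The last two hypotheses kill the terms in [x] and in
   D_x^{-1} (_ y). *)
Theorem lie_identity (P : M -> M) a g1 h1 G1 H1 g2 h2 G2 H2 x :
    d x = y ->
    (forall z, P z =
      a *: d z + d (a *: z) + nonlocal g1 h1 z + nonlocal g2 h2 z) ->
    E a = (U 0 * D a) *+ 2 - (U 1 * a) *+ 4 -> evolves a ->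
    nonlocal_pair g1 h1 G1 H1 -> nonlocal_pair g2 h2 G2 H2 ->
    (U 3 * a) *+ 2 + U 2 * D a + g1 * H1 + g2 * H2 = 0 ->
    (U 3 * a) *+ 2 + U 2 * D a + G1 * h1 + G2 * h2 = 0 ->
  eps (P y) - frechet_act (P y) + P (d (frechet_act x)) = 0.
Proof.
move=> dx PE Ea eva np1 np2 relH relG.
(* The local part of u_2 P y is the derivative of 2 u_2 a y, up to - (2 u_3 a + u_2 a') y. By [relG]
   this defect is the sum of the G_i h_i y, exactly what differentiating the terms G_i D_x^-1 h_i y
   produces besides u_2 g_i D_x^-1 h_i y. *)
have prim2 : p (U 2 *: P y) =
    (U 2 * a) *+ 2 *: y + nonlocal G1 h1 y + nonlocal G2 h2 y.
  apply: d_inj; rewrite pK PE !(raddfD d) !dZ !pK.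
  rewrite (nonlocal_DG np1) (nonlocal_DG np2) (raddfMn D) DM DU.
  apply: ev_inj => m; rewrite !evE; apply/eqP; rewrite -subr_eq0; apply/eqP.
  transitivity (- ((U 3 * a) *+ 2 + U 2 * D a + G1 * h1 + G2 * h2) * ev m y).
    by ring.
  by rewrite relG oppr0 mul0r.
have -> : d (frechet_act x) = (U 0 *: d y + U 1 *: y + U 2 *: x) *+ 2.
  rewrite frechet_actE (raddfMn d) (raddfD d) dZ pK DU dx.
  by congr ((_ + _) *+ _); rewrite addrC.
rewrite frechet_actE prim2.
have PMn z n : P (z *+ n) = P z *+ n.
  have P0 : P 0 = 0 by rewrite PE !(scaler0, raddf0 d, raddf0 p, addr0).
  have PD z1 z2 : P (z1 + z2) = P z1 + P z2.
    by rewrite !PE !(scalerDr, raddfD d, raddfD p); apply: ev_inj => m;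
      rewrite !evE; ring.
  by elim: n => // n IH; rewrite !mulrS PD IH.
rewrite PMn !PE !epsD (eps_nonlocal np1) (eps_nonlocal np2).
rewrite -dx (nonlocal_frechet _ np1) (nonlocal_frechet _ np2) dx.
have epsdy : eps (d y) = 0.
  by have := eps_d evolves1; rewrite !scale1r epsy (raddf0 d).
rewrite eps_d// !epsZ epsdy epsy !scaler0 !addr0.
rewrite (nonlocal_Eg np1) (nonlocal_Eg np2) Ea.
rewrite !(raddfD d, raddfB d, raddfMn d, dZ, pK).
rewrite !(raddfD D, raddfN D, raddfMn D, DM, DU).
apply: ev_inj => m; rewrite !evE.
rewrite dx; have -> : ev m 0 = 0 by rewrite -(scale0r y) evZ mul0r.
transitivity
  (((U 3 * a) *+ 2 + U 2 * D a + g1 * H1 + g2 * H2) * ev m x *+ 2);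
    first by ring.
by rewrite relH mul0r mul0rn.
Qed.
End LieIdentity.

(** * From series back to the coefficients of the Lie derivative *)

Section LieDerivative.
Variables (A : comPzRingType) (D E : {additive A -> A}).
Hypothesis DM : forall f g, D (f * g) = D f * g + f * D g.
Hypothesis EM : forall f g, E (f * g) = E f * g + f * E g.
Variable U : nat -> A.
Hypothesis DU : forall k, D (U k) = U k.+1.

Local Notation "P * Q" := (compop D P Q) : pdo_scope.
Local Notation Dop := (powD A 1).
Local Notation Dinv := (powD A (-1)).
Local Notation deriv := (deriv D).
Local Notation prim := (prim D).
Implicit Types (P R : pdo A) (x y : ser A) (f g h a : A).

Definition frechet : pdo A :=
  ((2 * U 0)%:O * Dop + (2 * U 1)%:O - 2 *: (Dinv * (U 1)%:O * Dop))%pdo.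

Definition lie R : pdo A := (mapop E R - frechet * R + R * frechet)%pdo.

(** A composition ending in D is the action of its left factors on [deriv one]; operator identities
    thus become identities of series. *)
Definition one : ser A := cls (mulop 1).

Lemma cls_Dop : cls Dop = deriv one.
Proof.
apply: serP => m; rewrite derivE !clsE !coefD_mulop coefD_powD subr_eq0.
by case: (m == 1); case: (m == 0); rewrite ?(D1 DM) ?raddf0 addr0.
Qed.


Local Notation Fx x := ((2 * U 0) *: deriv x + (2 * U 1) *: x -
  prim (U 1 *: deriv x) *~ 2).

Lemma act_frechet x : act D frechet x = Fx x.
Proof.
rewrite !(act_addop, act_oppop, act_scaleop, act_mulop) assocl_mulop act_mulop.
rewrite (assocl_compop (assocl_Dinv DM) (@assocl_mulop _ D (U 1))).
by rewrite (assocl_Dinv DM) act_mulop.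
Qed.

Lemma cls_frechet : cls frechet = Fx one.
Proof.
have clsD P P' : cls (P + P')%pdo = cls P + cls P'.
  by apply: serP => m; rewrite clsE coefD_add.
have clsN P : cls (- P)%pdo = - cls P.
  by apply: serP => m; rewrite clsE coefD_opp.
have clsZ c P : cls (c *: P)%pdo = cls P *~ c.
  by apply: serP => m; rewrite clsE coefD_scale cfMz.
have clsO f : cls f%:O%pdo = f *: one.
  by apply: serP => m; rewrite clsE cfZ clsE !coefD_mulop; case: eqP;
    rewrite ?mulr1 ?mulr0.
rewrite !(clsD, clsN, clsZ, clsO) -!act_cls cls_Dop act_mulop.
by rewrite (assocl_Dinv DM) act_mulop.
Qed.

Lemma mapserD : {morph mapser E : x y / x + y}.
Proof. by move=> x y; apply: serP => m; rewrite /= raddfD. Qed.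

Lemma mapserZ f x : mapser E (f *: x) = E f *: x + f *: mapser E x.
Proof. by apply: serP => m; rewrite /= EM. Qed.

(** The coefficients of D^n are 0 and 1, which [E] kills, so the first term of [mapser_act] is the
    action of the zero operator. *)
Lemma mapser_Dn (n : int) x :
    (forall m k, E (iter k D (x m)) = iter k D (E (x m))) ->
  mapser E (act D (powD A n) x) = act D (powD A n) (mapser E x).
Proof.
move=> xE; rewrite (mapser_act EM)// -[RHS]add0r; congr (_ + _).
rewrite -(scale0r x) -(act_mulop D); apply: act_ext => m.
rewrite coefD_map ?raddf0// coefD_powD coefD_mulop.
by case: (m == n); case: (m == 0); rewrite ?(D1 EM) ?raddf0.
Qed.


Lemma evolves_series f : evolves D E f ->
  forall m k, E (iter k D ((f *: deriv one) m)) = iter k D (E ((f *: deriv one)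
    m)).
Proof.
move=> ef m k; rewrite cfZ -cls_Dop clsE coefD_powD.
case: (m == 1); first by rewrite mulr1 ef.
by rewrite mulr0; apply: evolves0.
Qed.

Lemma mapser_deriv_one : mapser E (deriv one) = 0.
Proof.
apply: serP => m; rewrite -[LHS]/(E (deriv one m)) -cls_Dop clsE coefD_powD.
by case: (m == 1); rewrite ?(D1 EM) ?raddf0.
Qed.

Theorem lie_eq0 P a g1 h1 G1 H1 g2 h2 G2 H2 :
    assocl D P ->
    (forall x, act D P x = a *: deriv x + deriv (a *: x) +
      g1 *: prim (h1 *: x) + g2 *: prim (h2 *: x)) ->
    E a = (U 0 * D a) *+ 2 - (U 1 * a) *+ 4 -> evolves D E a ->
    nonlocal_pair D E U g1 h1 G1 H1 -> nonlocal_pair D E U g2 h2 G2 H2 ->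
    (U 3 * a) *+ 2 + U 2 * D a + g1 * H1 + g2 * H2 = 0 ->
    (U 3 * a) *+ 2 + U 2 * D a + G1 * h1 + G2 * h2 = 0 ->
  forall m, coefD (lie (P * Dop)%pdo) m = 0.
Proof.
move=> aP actP Ea eva np1 np2 relH relG m.
pose y := deriv one.
have := @lie_identity _ D E DM EM U DU _ int (fun m x => x m) (@serP A)
  (fun m x y => cfD x y m) (fun m f x => cfZ f x m) deriv prim (mapser E)
  (derivZ DM) (primK DM) (@deriv_inj _ D) mapserD mapserZ y mapser_deriv_one
  (fun f ev => mapser_Dn 1 (evolves_series ev))
  (fun f ev => mapser_Dn (-1) (evolves_series ev))
  (act D P) a g1 h1 G1 H1 g2 h2 G2 H2 one erefl actP Ea eva np1 np2 relH relG.
rewrite /frechet_act => lie0.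
rewrite /lie !coefD_add coefD_opp -!clsE cls_map -!act_cls cls_Dop -/y.
by rewrite act_frechet aP cls_frechet -cfN -!cfD lie0.
Qed.

End LieDerivative.

(** * The three operators over an abstract differential ring *)

Section RecursionOperators.
Variables (A : comPzRingType) (D E : {additive A -> A}).
Hypothesis DM : forall f g, D (f * g) = D f * g + f * D g.
Hypothesis EM : forall f g, E (f * g) = E f * g + f * E g.
Hypothesis torsion2 : forall f : A, f *+ 2 = 0 -> f = 0.
Variable U : nat -> A.
Hypothesis DU : forall k, D (U k) = U k.+1.
Hypothesis EU1 : E (U 1) = (U 0 * U 2) *+ 2 + U 1 * U 1.
Hypothesis EUS : forall k, E (U k.+2) = D (E (U k.+1)).

Local Notation "P * Q" := (compop D P Q) : pdo_scope.
Local Notation Dop := (powD A 1).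
Local Notation Dinv := (powD A (-1)).
Local Notation deriv := (deriv D).
Local Notation prim := (prim D).
Local Notation lie := (lie D E U).
Implicit Types (f g h r s t : A).

(** The concrete operators with the inverses and fractional powers turned into parameters, since [A]
    has no division. *)
Definition re1 r h : pdo A :=
  ((2 *: (r%:O * Dop) + 2 *: (Dop * r%:O) - h%:O * Dinv * h%:O) * Dop)%pdo.

Definition re2 f : pdo A :=
  ((f%:O * Dop + Dop * f%:O - 8 *: ((U 1)%:O * Dinv * (U 1)%:O)) * Dop)%pdo.

Definition re3 f g : pdo A :=
  ((f%:O * Dop + Dop * f%:O
    - 4 *: (g%:O * Dinv * (U 1)%:O) - 4 *: ((U 1)%:O * Dinv * g%:O)) * Dop)%pdo.

Lemma commDE_U n k : commDE D E n (U k.+1).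
Proof.
elim: n k => [|n IH] k; split=> //; rewrite /DE ?DU ?EUS ?subrr//.
Qed.

Lemma EU2 : E (U 2) = (U 0 * U 3) *+ 2 + (U 1 * U 2) *+ 4.
Proof. by rewrite EUS EU1 (raddfD D) (raddfMn D) !DM !DU; ring. Qed.

Lemma EU3 : E (U 3) = (U 0 * U 4) *+ 2 + (U 1 * U 3) *+ 6 + (U 2 * U 2) *+ 4.
Proof. by rewrite EUS EU2 (raddfD D) !(raddfMn D) !DM !DU; ring. Qed.

Lemma assocl_nonlocal g h : assocl D (g%:O * Dinv * h%:O)%pdo.
Proof. by do 2?[apply: assocl_compop];
  [exact: assocl_mulop|exact: assocl_Dinv|exact: assocl_mulop]. Qed.

Lemma assocl_skew f : assocl D (f%:O * Dop)%pdo /\ assocl D (Dop * f%:O)%pdo.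
Proof.
by split; apply: assocl_compop; try exact: assocl_mulop; exact: assocl_D.
Qed.

Lemma act_nonlocal g h x : act D (g%:O * Dinv * h%:O)%pdo x = g *: prim (h *:
  x).
Proof.
rewrite (assocl_compop (assocl_mulop _ _) (assocl_Dinv DM)) (act_mulop D h).
by rewrite assocl_mulop (act_mulop D g).
Qed.

Lemma act_local f x : act D (f%:O * Dop)%pdo x = f *: deriv x /\
  act D (Dop * f%:O)%pdo x = deriv (f *: x).
Proof. by split; rewrite (assocl_mulop, assocl_D DM) (act_mulop D f). Qed.

Lemma prim_Mn f n x : prim (f *+ n *: x) = prim (f *: x) *+ n.
Proof. by rewrite -scalerMnl raddfMn. Qed.

Lemma deriv_Mn f n x : deriv (f *+ n *: x) = deriv (f *: x) *+ n.
Proof. by rewrite -scalerMnl raddfMn. Qed.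

Lemma scaler_mul4 (V : lmodType A) f (z : V) :
  - (f *: z *~ 4) = - (f *+ 2) *: (z *+ 2).
Proof. by rewrite scaleNr -scalerMnl -scalerMnr -mulrnA pmulrn. Qed.

Theorem lie_re1 s t : s * s = U 2 -> s * t = 1 ->
  forall m, coefD (lie (re1 (t ^+ 2) (U 3 * t ^+ 3))) m = 0.
Proof.
(* With [v] naming [D s] one has u_2 = s^2 and u_3 = 2 s v, so the conditions become polynomial
   identities modulo the single relation [s * t = 1]. *)
move=> ss st; set h := U 3 * t ^+ 3;
  have [v Ds] : exists v, D s = v by exists (D s).
have cs n : commDE D E n s.
  exact: (commDE_sqrt DM EM torsion2 n ss st (fun k => commDE_U k 1)).
have ct n : commDE D E n t by apply: (commDE_inv DM EM st).
have U3E : U 3 = (s * v) *+ 2 by rewrite -DU -ss DM Ds; ring.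
have hE : h = (v * (t * t)) *+ 2 by rewrite /h U3E; ring: st.
have Dt : D t = - (t * t * v) by rewrite -Ds; apply: derivation_inv.
(* Differentiating s^2 = u_2 along the flow gives 2 s E(s); [t] cancels s and the absence of
   2-torsion cancels 2. *)
have Es : E s = (U 0 * v + U 1 * s) *+ 2.
  apply/eqP; rewrite -subr_eq0; apply/eqP/torsion2.
  have : E (s * s) = E (U 2) by rewrite ss.
  rewrite EM EU2 U3E -ss => e.
  transitivity (t * (E s * s + s * E s) - (t * s) * ((U 0 * v + U 1 * s) *+ 4)).
    by ring: st.
  by rewrite e; ring: st.
have Et : E t = - (t * t * E s) by apply: derivation_inv.
have Ev : E v = (U 1 * v + U 0 * D v + U 2 * s + U 1 * v) *+ 2.
  have /eqP := (cs 0%N).1; rewrite /DE subr_eq0 Ds => /eqP ->.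
  by rewrite Es (raddfMn D) (raddfD D) !DM !DU Ds; ring.
have Eh : E h = (U 0 * D h + s *+ 2) *+ 2.
  rewrite hE (raddfMn E) (raddfMn D) !EM !DM Dt Et Ev Es -ss.
  by ring: st.
have ch n : commDE D E n h by apply/commDE_M/commDE_X/ct => //; apply: commDE_U.
(* u_2 h = u_3 u_2^(-1/2) is the derivative of 2 u_2^(1/2); the minus sign of the nonlocal term goes
   to the left factor. *)
have np : nonlocal_pair D E U (- h) h (- (s *+ 2)) (s *+ 2).
  split.
  - by rewrite (raddfN D) (raddfMn D) Ds hE -ss; ring: st.
  - by rewrite (raddfMn D) Ds hE -ss; ring: st.
  - by rewrite (raddfN E) Eh (raddfN D); ring.
  - exact: Eh.
  - exact: (commDE_iter ch).
apply: (lie_eq0 DM EM DU (a := t ^+ 2 *+ 2)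
  _ _ _ _ np (nonlocal_pair0 _ _ _)).
- apply: assocl_addop; last exact/assocl_oppop/assocl_nonlocal.
  by apply: assocl_addop; apply: assocl_scaleop; case: (assocl_skew (t ^+ 2)).
- move=> x; rewrite !(act_addop, act_oppop, act_scaleop) act_nonlocal.
  rewrite (act_local _ x).1 (act_local _ x).2 deriv_Mn scale0r addr0.
  by rewrite -scalerMnl scaleNr -!pmulrn.
- rewrite expr2 (raddfMn E) (raddfMn D) EM DM Et Dt Es.
  by ring: st.
- apply: commDE_iter => n.
  by apply/commDE_Mn/commDE_X.
- by rewrite mul0r addr0 (raddfMn D) expr2 DM Dt hE U3E -ss; ring: st.
- by rewrite mulr0 addr0 (raddfMn D) expr2 DM Dt hE U3E -ss; ring: st.
Qed.

Theorem lie_re2 t : U 2 * t = 1 ->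
  forall m, coefD (lie (re2 (U 1 ^+ 4 * t ^+ 2))) m = 0.
Proof.
move=> Ut; set f := _ * _.
have ct n : commDE D E n t by apply: (commDE_inv DM EM Ut); apply: commDE_U.
have Dt : D t = - (t * t * U 3) by rewrite -DU; apply: derivation_inv.
have Et : E t = - (t * t * E (U 2)) by apply: derivation_inv.
have D4 : D (U 1 ^+ 4) = (U 1 ^+ 3 * U 2) *+ 4.
  by rewrite !exprS expr0 mulr1 !DM !DU; ring.
have E4 : E (U 1 ^+ 4) = (U 1 ^+ 3 * E (U 1)) *+ 4.
  by rewrite !exprS expr0 mulr1 !EM; ring.
(* 8 is split as 4 * 2 since u_1 u_2 has the antiderivative u_1^2 / 2. *)
have np : nonlocal_pair D E U (- (U 1 *+ 4)) (U 1 *+ 2)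
    (- ((U 1 * U 1) *+ 2)) (U 1 * U 1).
  split.
  - by rewrite (raddfN D) (raddfMn D) DM !DU; ring.
  - by rewrite DM !DU; ring.
  - by rewrite (raddfN E) (raddfN D) (raddfMn E) (raddfMn D) EU1 DU; ring.
  - by rewrite (raddfMn E) (raddfMn D) EU1 DU; ring.
  - by apply: commDE_iter => n; apply/commDE_Mn/commDE_U.
apply: (lie_eq0 DM EM DU (a := f) _ _ _ _ np (nonlocal_pair0 _ _ _)).
- apply: assocl_addop; last exact/assocl_oppop/assocl_scaleop/assocl_nonlocal.
  by apply: assocl_addop; case: (assocl_skew f).
- move=> x; rewrite !(act_addop, act_oppop, act_scaleop) act_nonlocal.
  rewrite (act_local _ x).1 (act_local _ x).2 scale0r addr0 prim_Mn.
  by rewrite scaleNr -scalerMnl -scalerMnr -mulrnA -pmulrn.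
- rewrite /f expr2 EM DM E4 D4 EM DM Et Dt EU1 EU2.
  by ring: Ut.
- apply: commDE_iter => n.
  by apply: (commDE_M DM EM); apply: (commDE_X DM EM) => //; apply: commDE_U.
- by rewrite mul0r addr0 /f expr2 DM D4 DM Dt; ring: Ut.
- by rewrite mulr0 addr0 /f expr2 DM D4 DM Dt; ring: Ut.
Qed.

Theorem lie_re3 t : U 1 * t = 1 ->
  forall m, coefD (lie (re3 (t ^+ 4) (U 3 * t ^+ 6 - (U 2 ^+ 2 * t ^+ 7) *+
    3))) m = 0.
Proof.
move=> Ut; set f := t ^+ 4; set g := _ - _.
have ct n : commDE D E n t by apply: (commDE_inv DM EM Ut); apply: commDE_U.
have Dt : D t = - (t * t * U 2) by rewrite -DU; apply: derivation_inv.
have Et : E t = - (t * t * E (U 1)) by apply: derivation_inv.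
have dX (d : {additive A -> A}) k : (forall f g, d (f * g) = d f * g + f * d g)
  ->
    d (t ^+ k.+1) = (t ^+ k * d t) *+ k.+1.
  move=> dM; elim: k => [|k IH]; first by rewrite expr1 expr0 mul1r.
  by rewrite exprS dM IH !mulrS !exprS; ring.
have DX k : D (t ^+ k.+1) = (t ^+ k * D t) *+ k.+1 by exact: dX.
have EX k : E (t ^+ k.+1) = (t ^+ k * E t) *+ k.+1 by exact: dX.
have cg n : commDE D E n g.
  apply: commDE_B; [|apply: commDE_Mn]; apply: (commDE_M DM EM);
    do ?apply: (commDE_X DM EM);
  by [exact: ct|exact: commDE_U].
(* u_2 g is half the derivative of u_2^2 u_1^(-6), and u_1 u_2 half that of u_1^2. Splitting each
   coefficient 4 as 2 * 2 doubles both factors and avoids the halves. *)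
pose G := U 2 ^+ 2 * t ^+ 6.
have DG : D G = U 2 * g *+ 2.
  by rewrite /G /g expr2 !(DX, DU, DM) Dt; ring: Ut.
have Eg : E g = (U 0 * D g) *+ 2 + G.
  rewrite /g /G expr2 (raddfB E) (raddfB D) !(raddfMn D) !(raddfMn E).
  by rewrite !(EX, EM) !(DX, DU, DM) Et Dt EU1 EU2 EU3; ring: Ut.
have np1 : nonlocal_pair D E U (- (g *+ 2)) (U 1 *+ 2) (- G) (U 1 * U 1).
  split.
  - by rewrite (raddfN D) DG; ring.
  - by rewrite DM !DU; ring.
  - by rewrite (raddfN E) (raddfN D) (raddfMn E) (raddfMn D) Eg; ring.
  - by rewrite (raddfMn E) (raddfMn D) EU1 DU; ring.
  - by apply: commDE_iter => n; apply/commDE_Mn/commDE_U.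
have np2 : nonlocal_pair D E U (- (U 1 *+ 2)) (g *+ 2) (- (U 1 * U 1)) G.
  split.
  - by rewrite (raddfN D) DM !DU; ring.
  - by rewrite DG; ring.
  - by rewrite (raddfN E) (raddfN D) (raddfMn E) (raddfMn D) EU1 DU; ring.
  - by rewrite (raddfMn E) (raddfMn D) Eg; ring.
  - by apply: commDE_iter => n; apply/commDE_Mn/cg.
apply: (lie_eq0 DM EM DU (a := f) _ _ _ _ np1 np2).
- do 2?[apply: assocl_addop;
  last exact/assocl_oppop/assocl_scaleop/assocl_nonlocal].
  by apply: assocl_addop; case: (assocl_skew f).
- move=> x; rewrite !(act_addop, act_oppop, act_scaleop) !act_nonlocal.
  rewrite (act_local _ x).1 (act_local _ x).2 !prim_Mn.
  by congr (_ + _ + _); apply: scaler_mul4.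
- by rewrite /f EX DX Et Dt EU1; ring: Ut.
- by apply: commDE_iter => n; apply: (commDE_X DM EM).
- by rewrite /f DX Dt /g /G; ring: Ut.
- by rewrite /f DX Dt /g /G; ring: Ut.
Qed.
End RecursionOperators.

(** * Differential functions on the jet space *)

Section Jets.
Variables (K : numFieldType) (Omega : set (jet K)).
Hypothesis Omega_open : open Omega.
Implicit Types (p q : jet K) (f g : jet K -> K) (i j : option nat) (b : bool).

Definition upd p i (t : K) : jet K := fun j => if j == i then t else p j.

Lemma upd_id p i : upd p i (p i) = p.
Proof. by apply/funext => j; rewrite /upd; case: eqP => // ->. Qed.

Lemma line_id f p i : line f p i (p i) = f p.
Proof. by rewrite -[LHS]/(f (upd p i (p i))) upd_id. Qed.

Lemma upd_continuous p i : continuous (upd p i).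
Proof.
have -> : upd p i = dfwith (p : forall _ : option nat, K) i.
  apply/funext => t; apply/funext => j; rewrite /upd /dfwith.
  by rewrite eq_sym; case: eqP => // ij; case: _ / ij.
exact: dfwith_continuous.
Qed.

Lemma near_upd p i : Omega p -> \forall t \near p i, Omega (upd p i t).
Proof.
move=> Op; apply: (@upd_continuous p i (p i)).
by rewrite upd_id; apply: open_nbhs_nbhs.
Qed.

Definition derivable_in i f p := derivable (line f p i) (p i) 1.

Lemma partialE i f p : partial i f p = 'D_1 (line f p i) (p i).
Proof. by rewrite /partial derive1E. Qed.

Section Pointwise.
Variables (i : option nat) (p : jet K).
Hypothesis Op : Omega p.

Lemma near_line f g : (forall q, Omega q -> f q = g q) ->
  \forall t \near p i, line f p i t = line g p i t.
Proof. by move=> fg; near=> t; apply: fg; near: t;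
  exact: near_upd. Unshelve. all: by end_near. Qed.

Lemma partial_congr f g : (forall q, Omega q -> f q = g q) ->
  partial i f p = partial i g p.
Proof. by move=> fg; rewrite !partialE; apply: near_eq_derive;
  exact: near_line. Qed.

Lemma derivable_congr f g : (forall q, Omega q -> f q = g q) ->
  derivable_in i f p -> derivable_in i g p.
Proof. by move=> fg; apply: near_eq_derivable; exact: near_line. Qed.

Lemma continuous_congr f g : (forall q, Omega q -> f q = g q) ->
  {for p, continuous f} -> {for p, continuous g}.
Proof.
move=> fg cf; have nfg : \forall q \near p, f q = g q.
  have : nbhs p Omega by apply: open_nbhs_nbhs.
  by apply: filterS => q /fg.
have := cvg_trans (near_eq_cvg nfg) cf; rewrite (fg p Op).
by apply; apply: nbhs_filter.
Qed.

Lemma partial_add f g : derivable_in i f p -> derivable_in i g p ->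
  partial i (f + g) p = partial i f p + partial i g p.
Proof. by move=> df dg; rewrite !partialE -deriveD. Qed.

Lemma partial_opp f : derivable_in i f p -> partial i (- f) p = - partial i f p.
Proof. by move=> df; rewrite !partialE -deriveN. Qed.

Lemma partial_mul f g : derivable_in i f p -> derivable_in i g p ->
  partial i (f * g) p = partial i f p * g p + f p * partial i g p.
Proof.
move=> df dg; rewrite !partialE.
rewrite (_ : line (f * g) p i = line f p i * line g p i)// deriveM//.
rewrite !line_id addrC.
rewrite [X in _ = X + _]mulrC; congr (_ + _).
Qed.

Lemma partial_recip f : f p != 0 -> derivable_in i f p ->
  partial i (recip f) p = - (recip f p ^+ 2 * partial i f p).
Proof.
move=> f0 df; rewrite !partialE.
rewrite (_ : line (recip f) p i = fun t => (line f p i t)^-1)//.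
by rewrite deriveV ?line_id// scaleNr -exprVn; congr (- _).
Qed.

Lemma partial_cst (c : K) : partial i (cst c) p = 0.
Proof. by rewrite partialE; exact: derive_cst. Qed.

Lemma partial_coord j : partial i (fun q => q j) p = (i == j)%:R.
Proof.
rewrite partialE; have [<-|ij] := eqVneq i j.
  by rewrite (_ : line _ p i = id) ?derive_id//; apply/funext => t;
    rewrite /line eqxx.
rewrite (_ : line _ p i = cst (p j)) ?derive_cst//.
by apply/funext => t; rewrite /line eq_sym (negbTE ij).
Qed.

Lemma derivable_coord j : derivable_in i (fun q => q j) p.
Proof.
rewrite /derivable_in; have [<-|ij] := eqVneq i j.
  rewrite (_ : line _ p i = id); first exact: derivable_id.
  by apply/funext => t; rewrite /line eqxx.
rewrite (_ : line _ p i = cst (p j)); first exact: derivable_cst.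
by apply/funext => t; rewrite /line eq_sym (negbTE ij).
Qed.

End Pointwise.

(* The least class that lets smoothness be proved coinductively: it contains the
   smooth functions and is stable under the operations and partial derivatives.
     *)
Inductive generated : (jet K -> K) -> Prop :=
| generated_smooth f : smooth Omega f -> generated f
| generated_cst c : generated (cst c)
| generated_coord j : generated (fun q => q j)
| generated_add f g : generated f -> generated g -> generated (f + g)
| generated_opp f : generated f -> generated (- f)
| generated_mul f g : generated f -> generated g -> generated (f * g)
| generated_recip f : (forall q, Omega q -> f q != 0) -> generated f ->
    generated (recip f)
| generated_congr f g : (forall q, Omega q -> f q = g q) -> generated f ->
    generated g.

Lemma smooth_partial i f : smooth Omega f -> smooth Omega (partial i f).
Proof.
move=> sf s p Op; have := sf (rcons s i) p Op.
by rewrite /iter_partial foldr_rcons.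
Qed.

(** The invariant that reduces smoothness to an induction on the list of partial derivatives. The
    differentiation formulas hold on [Omega] only, whence the constructor [generated_congr]. *)
Lemma generatedP f : generated f ->
  [/\ forall p, Omega p -> {for p, continuous f},
      forall p i, Omega p -> derivable_in i f p &
      forall i, generated (partial i f)].
Proof.
elim=> {f} [f sf|c|j|f g _ [cf df pf] _ [cg dg pg]|f _ [cf df pf]
  |f g Gf [cf df pf] Gg [cg dg pg]|f f0 Gf [cf df pf]|f g fg _ [cf df pf]].
- split=> [p Op|p i Op|i].
  + exact: (sf [::] p Op).1.
  + exact: (sf [::] p Op).2.
  + exact/generated_smooth/smooth_partial.
- split=> [p Op|p i Op|i]; first exact: cst_continuous.
    exact: derivable_cst.
  apply: (generated_congr _ (generated_cst 0)) => p Op.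
  by rewrite partial_cst.
- split=> [p Op|p i Op|i]; first exact: proj_continuous.
    exact: derivable_coord.
  apply: (generated_congr _ (generated_cst (i == j)%:R)) => p Op.
  by rewrite partial_coord.
- split=> [p Op|p i Op|i].
  + by apply: continuousD; [exact: cf|exact: cg].
  + by apply: derivableD; [exact: df|exact: dg].
  + apply: (generated_congr _ (generated_add (pf i) (pg i))) => p Op.
    by rewrite partial_add//; [exact: df|exact: dg].
- split=> [p Op|p i Op|i].
  + by apply: continuousN; exact: cf.
  + by apply: derivableN; exact: df.
  + apply: (generated_congr _ (generated_opp (pf i))) => p Op.
    by rewrite partial_opp//; exact: df.
- split=> [p Op|p i Op|i].
  + by apply: continuousM; [exact: cf|exact: cg].
  + by apply: derivableM; [exact: df|exact: dg].
  + apply: (generated_congr _ (generated_add (generated_mul (pf i) Gg)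
      (generated_mul Gf (pg i)))) => p Op.
    by rewrite partial_mul//; [exact: df|exact: dg].
- split=> [p Op|p i Op|i].
  + by apply: continuousV; [exact: f0|exact: cf].
  + rewrite /derivable_in.
    rewrite (_ : line (recip f) p i = fun t => (line f p i t)^-1)//.
    by apply: derivableV; [rewrite line_id; exact: f0|exact: df].
  + have Gr := generated_recip f0 Gf.
    apply: (generated_congr _ (generated_opp (generated_mul
      (generated_mul Gr Gr) (pf i)))) => p Op.
    by rewrite partial_recip//; [exact: f0|exact: df].
- split=> [p Op|p i Op|i].
  + by apply: (continuous_congr Op fg); exact: cf.
  + by apply: (derivable_congr Op fg); exact: df.
  + apply: (generated_congr _ (pf i)) => p Op.
    exact: partial_congr.
Qed.

Lemma smooth_generated f : generated f -> smooth Omega f.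
Proof.
move=> Gf s p Op; have {}Gf : generated (iter_partial s f).
  by elim: s => //= i s /generatedP[].
by have [cf df _] := generatedP Gf; split=> [|i]; [exact: cf|exact: df].
Qed.

End Jets.

(** * Functions of finitely many coordinates, and derivations as vector fields *)

Section DifferentialFunctions.
Variables (K : numFieldType) (Omega : set (jet K)).
Hypothesis Omega_open : open Omega.
Implicit Types (p q : jet K) (f g : jet K -> K) (i j : option nat) (b : bool).

(* [b] tells whether dependence on the nonlocal variable is allowed. *)
Definition in_range b n i := if i is Some k then (k < n)%N else b.

Definition agree b n p q := forall i, in_range b n i -> p i = q i.

Definition depends b n f := forall p q, Omega p -> Omega q ->
  agree b n p q -> f p = f q.

(** [nice false] is the class of differential functions. The larger class [nice true] contains [HS],
    hence is stable under the evolutionary derivation. *)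
Definition nice b f := smooth Omega f /\ exists n, depends b n f.

Lemma agree_le b n n' p q : (n <= n')%N -> agree b n' p q -> agree b n p q.
Proof. by move=> nn' pq [k|] //= kn; apply: pq => //=;
  exact: leq_trans nn'. Qed.

Lemma depends_le b n n' f : (n <= n')%N -> depends b n f -> depends b n' f.
Proof. by move=> nn' df p q Op Oq /(agree_le nn'); apply: df. Qed.

Lemma niceW b f : nice b f -> nice true f.
Proof.
move=> [sf [n df]]; split=> //; exists n => p q Op Oq pq; apply: df => //.
by move=> [k|] //= kb; apply: pq.
Qed.

Lemma differential_functionP f : differential_function Omega f <-> nice false f.
Proof.
split=> -[sf [n df]]; split=> //; exists n => p q Op Oq pq; apply: df => //.
  by move=> k kn; apply: pq.
by move=> [k|] //; exact: pq.
Qed.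

Lemma nice_congr b f g : (forall p, Omega p -> f p = g p) ->
  nice b f -> nice b g.
Proof.
move=> fg [sf [n df]]; split.
  apply: (smooth_generated Omega_open); apply: (generated_congr fg).
  exact: generated_smooth.
by exists n => p q Op Oq pq; rewrite -!fg//; exact: df.
Qed.

Lemma nice_cst b (c : K) : nice b (cst c).
Proof.
split; first exact/(smooth_generated Omega_open)/generated_cst.
by exists 0%N.
Qed.

Lemma nice_u b k : nice b (u k).
Proof.
split; first exact/(smooth_generated Omega_open)/generated_coord.
by exists k.+1 => p q _ _ pq; apply: pq => /=.
Qed.

Lemma nice_w : nice true (@w K).
Proof.
split; first exact/(smooth_generated Omega_open)/generated_coord.
by exists 0%N => p q _ _ pq; apply: pq.
Qed.

Section Binary.
Variable op : K -> K -> K.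
Lemma depends_op b f g n n' : depends b n f -> depends b n' g ->
  depends b (maxn n n') (fun p => op (f p) (g p)).
Proof.
move=> df dg p q Op Oq pq.
by congr op; [apply: df|apply: dg] => //; apply: agree_le pq;
  rewrite ?leq_maxl ?leq_maxr.
Qed.
End Binary.

Lemma nice_add b f g : nice b f -> nice b g -> nice b (f + g).
Proof.
move=> [sf [n df]] [sg [n' dg]]; split; last first.
  by exists (maxn n n'); exact: (depends_op (fun x y => x + y) df dg).
by apply/(smooth_generated Omega_open)/generated_add; exact: generated_smooth.
Qed.

Lemma nice_nat b n : nice b n%:R.
Proof.
elim: n => [|n IH]; first exact: nice_cst.
by rewrite mulrS; apply: nice_add => //; exact: nice_cst.
Qed.

Lemma nice_mul b f g : nice b f -> nice b g -> nice b (f * g).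
Proof.
move=> [sf [n df]] [sg [n' dg]]; split; last first.
  by exists (maxn n n'); exact: (depends_op (fun x y => x * y) df dg).
by apply/(smooth_generated Omega_open)/generated_mul; exact: generated_smooth.
Qed.

Lemma nice_opp b f : nice b f -> nice b (- f).
Proof.
move=> [sf [n df]]; split; last first.
  by exists n => p q Op Oq pq; congr (- _); exact: df.
by apply/(smooth_generated Omega_open)/generated_opp; exact: generated_smooth.
Qed.

Lemma nice_recip b f : (forall p, Omega p -> f p != 0) ->
  nice b f -> nice b (recip f).
Proof.
move=> f0 [sf [n df]]; split; last first.
  by exists n => p q Op Oq pq; congr (_^-1); exact: df.
by apply/(smooth_generated Omega_open)/generated_recip => //;
  exact: generated_smooth.
Qed.

Lemma nice_sum b n (F : nat -> jet K -> K) : (forall k, nice b (F k)) ->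
  nice b (\sum_(k < n) F k).
Proof.
move=> nF; elim: n => [|n IH]; first by rewrite big_ord0; exact: nice_cst.
by rewrite big_ord_recr; apply: nice_add.
Qed.

Lemma nice_derivable b f i p : nice b f -> Omega p -> derivable_in i f p.
Proof. by move=> [sf _] Op; exact: (sf [::] p Op).2. Qed.

Lemma partial_out b n i f p : depends b n f -> Omega p -> ~~ in_range b n i ->
  partial i f p = 0.
Proof.
move=> df Op ir; rewrite partialE -[RHS](derive_cst (f p) (p i) 1).
apply: near_eq_derive; near=> t.
have Ot : Omega (upd p i t) by near: t; exact: near_upd.
apply: (df (upd p i t)) => // j jr; rewrite /upd; case: eqP => // ji.
by rewrite -ji jr in ir.
Unshelve. all: by end_near. Qed.

Lemma depends_partial b n i f : depends b n f -> depends b n (partial i f).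
Proof.
move=> df p q Op Oq pq; have [ir|ir] := boolP (in_range b n i); last first.
  by rewrite !(partial_out df _ ir).
(* [p] and [q] share coordinate i, so both lines are compared near the same point, and overwriting
   that coordinate by [t] preserves the agreement. *)
rewrite !partialE -(pq _ ir); apply: near_eq_derive; near=> t.
have Opt : Omega (upd p i t) by near: t; exact: near_upd.
have Oqt : Omega (upd q i t) by near: t; rewrite (pq _ ir); exact: near_upd.
by apply: (df (upd p i t) (upd q i t)) => // j jr; rewrite /upd;
  case: eqP => // _; exact: (pq _ jr).
Unshelve. all: by end_near. Qed.

Lemma nice_partial b i f : nice b f -> nice b (partial i f).
Proof.
move=> [sf [n df]]; split; first exact: smooth_partial.
by exists n; exact: depends_partial.
Qed.

Lemma fsum_ord (F : nat -> K) n : (forall k, (n <= k)%N -> F k = 0) ->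
  \sum_(k \in [set: nat]) F k = \sum_(k < n) F k.
Proof.
move=> F0; rewrite fsbig_ord; apply/esym/fsbig_widen => // k [_ /=] /negP.
by rewrite -leqNgt; exact: F0.
Qed.

(** The common shape of [Dx] and [evol Q], whose sum and product rules are thus proved once. As
    [evol] has no d/dw component, it does not commute with [Dx] on w; commutation is used only on
    functions built from the u_k with k > 0. *)
Definition vfield (c0 : jet K -> K) (c : nat -> jet K -> K) f : jet K -> K :=
  fun p => c0 p * partial None f p
    + \sum_(k \in [set: nat]) c k p * partial (Some k) f p.

Lemma Dx_vfield f : Dx f = vfield (u 1 ^+ 2) (fun k => u k.+1) f.
Proof. by []. Qed.

Lemma evol_vfield Q f : evol Q f = vfield 0 (fun k => iter k (@Dx K) Q) f.
Proof. by apply/funext => p; rewrite /vfield mul0r add0r. Qed.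

Section VectorField.
Variables (c0 : jet K -> K) (c : nat -> jet K -> K).
Local Notation V := (vfield c0 c).

Lemma vfieldE b n f p : depends b n f -> Omega p ->
  V f p = c0 p * partial None f p + \sum_(k < n) c k p * partial (Some (k :
    nat)) f p.
Proof.
move=> df Op; congr (_ + _); apply: fsum_ord => k nk.
by rewrite (partial_out df)// ?mulr0//= -leqNgt.
Qed.

Lemma vfield_congr f g p : (forall q, Omega q -> f q = g q) -> Omega p ->
  V f p = V g p.
Proof.
move=> fg Op; rewrite /vfield (partial_congr Omega_open None Op fg);
  congr (_ + _).
by apply: eq_fsbigr => k _; rewrite (partial_congr Omega_open (Some k) Op fg).
Qed.

Lemma nice_vfield b f : (b -> nice b c0) -> (forall k, nice b (c k)) ->
  nice b f -> nice b (V f).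
Proof.
move=> nc0 nc nf; have [sf [n df]] := nf.
(* For [b = false] the d/dw term vanishes on [Omega], so [c0] is unconstrained. *)
pose g := (if b then c0 * partial None f else 0)
  + \sum_(k < n) c k * partial (Some (k : nat)) f.
apply: (@nice_congr _ g) => [p Op|].
  rewrite (vfieldE df Op) /g; congr (_ + _); last by rewrite !fct_sumE.
  case: b {nc0 nc nf g} df => // df; by rewrite (partial_out df)// mulr0.
apply: nice_add; last first.
  apply: (@nice_sum _ _ (fun k => c k * partial (Some k) f)) => k.
  by apply: nice_mul => //; exact: nice_partial.
case: b nc0 nf {nc df g} => nc0 nf; last exact: nice_cst.
by apply: nice_mul; [exact: nc0|exact: nice_partial].
Qed.

Lemma vfield_add b f g p : nice b f -> nice b g -> Omega p ->
  V (f + g) p = V f p + V g p.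
Proof.
move=> nf ng Op; have [[_ [n df]] [_ [n' dg]]] := (nf, ng).
have dfg := depends_op (fun x y => x + y) df dg.
rewrite (vfieldE dfg Op) (vfieldE (depends_le (leq_maxl n n') df) Op).
rewrite (vfieldE (depends_le (leq_maxr n n') dg) Op) addrACA -big_split /=.
have pa i : partial i (f + g) p = partial i f p + partial i g p.
  exact: (partial_add (nice_derivable nf Op) (nice_derivable ng Op)).
rewrite pa mulrDr; congr (_ + _); apply: eq_bigr => k _.
by rewrite pa mulrDr.
Qed.

Lemma vfield_mul b f g p : nice b f -> nice b g -> Omega p ->
  V (f * g) p = V f p * g p + f p * V g p.
Proof.
move=> nf ng Op; have [[_ [n df]] [_ [n' dg]]] := (nf, ng).
have dfg := depends_op (fun x y => x * y) df dg.
rewrite (vfieldE dfg Op) (vfieldE (depends_le (leq_maxl n n') df) Op).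
rewrite (vfieldE (depends_le (leq_maxr n n') dg) Op).
rewrite mulrDl mulrDr addrACA mulr_suml mulr_sumr -big_split /=.
have pa i : partial i (f * g) p = partial i f p * g p + f p * partial i g p.
  exact: (partial_mul (nice_derivable nf Op) (nice_derivable ng Op)).
rewrite pa; congr (_ + _); first by ring.
by apply: eq_bigr => k _; rewrite pa; ring.
Qed.

Lemma vfield_coord j p : Omega p ->
  V (fun q => q j) p = if j is Some k then c k p else c0 p.
Proof.
move=> Op; have dj : depends true (if j is Some k then k.+1 else 0%N) (fun q =>
  q j).
  by move=> q q' _ _ qq'; apply: qq'; case: j => /=.
rewrite (vfieldE dj Op) partial_coord//; case: j dj => [k|] _.
  rewrite mulr0 add0r big_ord_recr /= partial_coord// eqxx mulr1.
  rewrite big1 ?add0r// => l _; rewrite partial_coord//.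
  by rewrite (_ : Some _ == _ = false) ?mulr0//; apply/eqP => -[];
    have := ltn_ord l; lia.
by rewrite mulr1 big_ord0 addr0.
Qed.

End VectorField.

Lemma nice_Dx b f : nice b f -> nice b (Dx f).
Proof.
move=> nf; rewrite Dx_vfield; apply: nice_vfield => // [_|k];
  last exact: nice_u.
by rewrite expr2; apply: nice_mul; exact: nice_u.
Qed.

Lemma nice_iterDx b k f : nice b f -> nice b (iter k (@Dx K) f).
Proof. by move=> nf; elim: k => //= k; exact: nice_Dx. Qed.

Lemma nice_HS : nice true (@HS K).
Proof.
apply: nice_add; last exact/nice_opp/nice_w.
by apply: nice_mul; [apply: nice_mul;
  [exact: nice_nat|exact: nice_u]|exact: nice_u].
Qed.

Lemma nice_evol f : nice true f -> nice true (evol (@HS K) f).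
Proof.
move=> nf; rewrite evol_vfield; apply: nice_vfield => // [_|k].
  exact: nice_cst.
by apply: nice_iterDx; exact: nice_HS.
Qed.

End DifferentialFunctions.

(** * The differential ring of functions on an open set *)

Section FunctionRing.
Variable K : numFieldType.
Implicit Types (Omega : set (jet K)).

(* Functions are compared on [Omega] only; requiring them to vanish elsewhere
   turns this into Leibniz equality. The unit is the indicator of [Omega]. *)
Definition normalized Omega of open Omega : {pred jet K -> K} :=
  [pred f | `[< nice Omega true f /\ forall p, ~ Omega p -> f p = 0 >]].

Fact normalized_zmod Omega (oO : open Omega) :
  GRing.zmod_closed (normalized oO).
Proof.
split=> [|f g /asboolP[nf f0] /asboolP[ng g0]]; apply/asboolP; split=> //.
- exact: nice_cst.
- by apply: nice_add => //; exact: nice_opp.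
- by move=> p Op; rewrite !fctE f0// g0// subr0.
Qed.

HB.instance Definition _ Omega (oO : open Omega) :=
  GRing.isZmodClosed.Build (jet K -> K) (normalized oO) (normalized_zmod oO).

(** The openness proof indexes the type because closure of smooth functions under the operations,
    hence the ring structure, is built from it. *)
Record fring Omega (oO : open Omega) :=
  FRing { fval : jet K -> K; fvalP : fval \in normalized oO }.
HB.instance Definition _ Omega (oO : open Omega) := [isSub for @fval Omega oO].
HB.instance Definition _ Omega (oO : open Omega) := [Choice of fring oO by <:].
HB.instance Definition _ Omega (oO : open Omega) :=
  [SubChoice_isSubZmodule of fring oO by <:].

Section Ring.
Variables (Omega : set (jet K)) (oO : open Omega).
Local Notation B := (fring oO).
Implicit Types (x y z : B) (p : jet K) (f g : jet K -> K).

Lemma fval_nice x : nice Omega true (fval x).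
Proof. by case: x => f /= /asboolP[]. Qed.

Lemma fringP x y : (forall p, Omega p -> fval x p = fval y p) -> x = y.
Proof.
move=> xy; apply: val_inj; apply/funext => p.
have [Op|Op] := pselect (Omega p); first exact: xy.
have out z : fval z p = 0 by case: z => f /= /asboolP[_]; apply.
by rewrite -[LHS]/(fval x p) -[RHS]/(fval y p) !out.
Qed.

Fact norm_normalized f : nice Omega true f ->
  (fun p => if `[< Omega p >] then f p else 0) \in normalized oO.
Proof.
move=> nf; apply/asboolP; split=> [|p Op].
  by apply: (nice_congr oO _ nf) => p Op; rewrite asboolT.
by rewrite asboolF.
Qed.
Definition norm f (nf : nice Omega true f) : B := FRing (norm_normalized nf).

Lemma fval_norm f (nf : nice Omega true f) p : Omega p -> fval (norm nf) p = f
  p.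
Proof. by move=> Op /=; rewrite asboolT. Qed.

Definition fmul x y := norm (nice_mul oO (fval_nice x) (fval_nice y)).
Definition fone := norm (nice_cst oO true 1).

Lemma fval_mul x y p : Omega p -> fval (fmul x y) p = fval x p * fval y p.
Proof. exact: fval_norm. Qed.

Fact fmulA : associative fmul.
Proof. by move=> x y z; apply: fringP => p Op; rewrite !fval_mul// mulrA. Qed.
Fact fmulC : commutative fmul.
Proof. by move=> x y; apply: fringP => p Op; rewrite !fval_mul// mulrC. Qed.
Fact fmul1 : left_id fone fmul.
Proof. by move=> x; apply: fringP => p Op;
  rewrite fval_mul// fval_norm// mul1r. Qed.
Fact fmulDl : left_distributive fmul +%R.
Proof.
move=> x y z; apply: fringP => p Op.
rewrite fval_mul//= -[RHS]/(fval (fmul x z) p + fval (fmul y z) p) !fval_mul//.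
by rewrite -mulrDl.
Qed.
HB.instance Definition _ :=
  GRing.Zmodule_isComPzRing.Build B fmulA fmulC fmul1 fmulDl.

Lemma fvalD x y p : fval (x + y) p = fval x p + fval y p. Proof. by []. Qed.
Lemma fvalN x p : fval (- x) p = - fval x p. Proof. by []. Qed.
Lemma fval0 p : fval (0 : B) p = 0. Proof. by []. Qed.
Lemma fval1 p : Omega p -> fval (1 : B) p = 1. Proof. exact: fval_norm. Qed.
Lemma fvalM x y p : Omega p -> fval (x * y) p = fval x p * fval y p.
Proof. exact: fval_mul. Qed.
Lemma fvalMn x (n : nat) p : fval (x *+ n) p = fval x p *+ n.
Proof. by elim: n => // n IH; rewrite !mulrS fvalD IH. Qed.
Lemma fvalMz x (n : int) p : fval (x *~ n) p = fval x p *~ n.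
Proof. by case: n => n; rewrite ?NegzE ?mulrNz ?fvalN -!pmulrn fvalMn. Qed.
Lemma fvalX x n p : Omega p -> fval (x ^+ n) p = fval x p ^+ n.
Proof.
by move=> Op; elim: n => [|n IH]; [exact: fval1|rewrite !exprS fvalM ?IH].
Qed.
Lemma fval_sum n (F : 'I_n -> B) p :
  fval (\sum_(i < n) F i) p = \sum_(i < n) fval (F i) p.
Proof. by elim/big_rec2: _ => // i y z _ <-. Qed.

Lemma fring_torsion x : x *+ 2 = 0 -> x = 0.
Proof.
move=> x2; apply: fringP => p Op; apply/eqP.
by have /eqP := congr1 (fun z => fval z p) x2; rewrite fvalMn fval0 mulrn_eq0.
Qed.

Definition fDx x : B := norm (nice_Dx oO (fval_nice x)).
Definition fevol x : B := norm (nice_evol oO (fval_nice x)).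

Lemma fval_fDx x p : Omega p -> fval (fDx x) p = Dx (fval x) p.
Proof. exact: fval_norm. Qed.
Lemma fval_fevol x p : Omega p -> fval (fevol x) p = evol (@HS K) (fval x) p.
Proof. exact: fval_norm. Qed.

Fact fDx_add : {morph fDx : x y / x + y}.
Proof.
move=> x y; apply: fringP => p Op; rewrite fvalD !fval_fDx//.
by rewrite !Dx_vfield (vfield_add oO _ _ (fval_nice x) (fval_nice y)).
Qed.
Fact fDx0 : fDx 0 = 0.
Proof. by apply: (addrI (fDx 0)); rewrite -fDx_add !addr0. Qed.
HB.instance Definition _ := GRing.isNmodMorphism.Build B B fDx (conj fDx0
  fDx_add).

Fact fevol_add : {morph fevol : x y / x + y}.
Proof.
move=> x y; apply: fringP => p Op; rewrite fvalD !fval_fevol//.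
by rewrite !evol_vfield (vfield_add oO _ _ (fval_nice x) (fval_nice y)).
Qed.
Fact fevol0 : fevol 0 = 0.
Proof. by apply: (addrI (fevol 0)); rewrite -fevol_add !addr0. Qed.
HB.instance Definition _ :=
  GRing.isNmodMorphism.Build B B fevol (conj fevol0 fevol_add).

Lemma fDxM x y : fDx (x * y) = fDx x * y + x * fDx y.
Proof.
apply: fringP => p Op; rewrite fvalD !fvalM// !fval_fDx//.
rewrite !Dx_vfield -(vfield_mul oO _ _ (fval_nice x) (fval_nice y))//.
by apply: (vfield_congr oO) => // q Oq; rewrite fvalM.
Qed.

Lemma fevolM x y : fevol (x * y) = fevol x * y + x * fevol y.
Proof.
apply: fringP => p Op; rewrite fvalD !fvalM// !fval_fevol//.
rewrite !evol_vfield -(vfield_mul oO _ _ (fval_nice x) (fval_nice y))//.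
by apply: (vfield_congr oO) => // q Oq; rewrite fvalM.
Qed.

Lemma iter_fDx k x f p : (forall q, Omega q -> f q = fval x q) -> Omega p ->
  iter k (@Dx K) f p = fval (iter k fDx x) p.
Proof.
move=> fx; elim: k p => [|k IH] p Op; first exact: fx.
by rewrite !iterS fval_fDx// !Dx_vfield; apply: (vfield_congr oO).
Qed.

Definition fu k : B := norm (nice_u oO true k).
Definition fw : B := norm (nice_w oO).

Lemma fDx_u k : fDx (fu k) = fu k.+1.
Proof.
apply: fringP => p Op; rewrite fval_fDx// fval_norm// Dx_vfield.
rewrite -[RHS](vfield_coord oO (u 1 ^+ 2) (fun k => u k.+1) (Some k) Op).
by apply: (vfield_congr oO) => // q Oq; rewrite fval_norm.
Qed.

Lemma fDx_w : fDx fw = fu 1 * fu 1.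
Proof.
apply: fringP => p Op; rewrite fval_fDx// fvalM// !fval_norm// Dx_vfield.
rewrite -expr2 -[RHS](vfield_coord oO (u 1 ^+ 2) (fun k => u k.+1) None Op).
by apply: (vfield_congr oO) => // q Oq; rewrite fval_norm.
Qed.

Lemma fevol_u k : fevol (fu k) = iter k fDx ((fu 0 * fu 1) *+ 2 - fw).
Proof.
apply: fringP => p Op; rewrite fval_fevol// evol_vfield.
rewrite -(iter_fDx k (f := @HS K)) => // [|q Oq].
  rewrite -[RHS](vfield_coord oO 0 (fun k => iter k (@Dx K) (@HS K)) (Some k)
    Op).
  by apply: (vfield_congr oO) => // q Oq; rewrite fval_norm.
rewrite fvalD fvalN fvalMn fvalM// !fval_norm//.
(* The numeral 2 in [HS] is a constant function, which at [q] computes to 1 + 1. *)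
by rewrite -[LHS]/((1 + 1) * u 0 q * u 1 q - w q); ring.
Qed.

(** One application of D_x replaces w by u_1^2, so the flow of u_1 is already local. *)
Lemma fevol_u1 : fevol (fu 1) = (fu 0 * fu 2) *+ 2 + fu 1 * fu 1.
Proof.
by rewrite fevol_u /= raddfB raddfMn /= fDxM fDx_w !fDx_u; ring.
Qed.

Lemma fevol_uS k : fevol (fu k.+2) = fDx (fevol (fu k.+1)).
Proof. by rewrite !fevol_u. Qed.

End Ring.
End FunctionRing.

(** * Transfer to operators on the jet space *)

Section Transfer.
Variables (K : numFieldType) (Omega : set (jet K)) (oO : open Omega).
Local Notation B := (fring oO).
Local Notation nice := (nice Omega).
Implicit Types (P Q R : operator K) (f g : jet K -> K) (x y : B) (p : jet K)
  (X Y Z : pdo B).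

Definition represents f x := forall p, Omega p -> f p = fval x p.

(** Orders and stored sequences are matched, rather than [coefD] alone, because [compop] is computed
    from them; compatibility with each operation is then a pointwise check. *)
Definition rep P (X : pdo B) :=
  pdo_ord P = pdo_ord X /\ forall n, represents (pdo_seq P n) (pdo_seq X n).

Lemma rep_coef P X m : rep P X -> represents (coefD P m) (coefD X m).
Proof. by move=> [oP sP] p Op; rewrite /coefD oP; case: ifP => // _;
  exact: sP. Qed.

Lemma rep_mulop f x : represents f x -> rep (mulop f) (mulop x).
Proof. by move=> fx; split=> // n p Op /=; case: (n == 0%N) => //;
  exact: fx. Qed.

Lemma rep_powD m : rep (powD (jet K -> K) m) (powD B m).
Proof.
by split=> // n p Op /=; case: (n == 0%N) => //; rewrite fval1.
Qed.

Lemma rep_addop P X Q Y : rep P X -> rep Q Y ->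
  rep (addop P Q) (addop X Y).
Proof.
move=> rP rQ; split=> [|n p Op]; first by rewrite /= rP.1 rQ.1.
rewrite /= rP.1 rQ.1 -[LHS]/(coefD P _ p + coefD Q _ p).
by rewrite (rep_coef _ rP Op) (rep_coef _ rQ Op).
Qed.

Lemma rep_oppop P X : rep P X -> rep (oppop P) (oppop X).
Proof.
move=> [oP sP]; split=> // n p Op /=.
by rewrite -[LHS]/(- pdo_seq P n p) (sP n p Op).
Qed.

Lemma fctMz f (n : int) p : (f *~ n) p = f p *~ n.
Proof.
have fctMn (k : nat) : (f *+ k) p = f p *+ k.
  by elim: k => // k IH; rewrite !mulrS -[LHS]/(f p + (f *+ k) p) IH.
by case: n => n; rewrite ?NegzE ?mulrNz -!pmulrn -?fctMn.
Qed.

Lemma rep_scaleop c P X : rep P X -> rep (scaleop c P) (scaleop c X).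
Proof.
move=> [oP sP]; split=> // n p Op /=.
by rewrite fctMz fvalMz (sP n p Op).
Qed.

Lemma rep_compop P X Q Y : rep P X -> rep Q Y ->
  rep (compop (@Dx K) P Q) (compop (@fDx K Omega oO) X Y).
Proof.
move=> [oP sP] [oQ sQ]; split=> [|n p Op]; first by rewrite /= oP oQ.
rewrite /= oP fct_sumE fval_sum; apply: eq_bigr => i _.
rewrite fct_sumE fval_sum; apply: eq_bigr => j _.
rewrite fctMz fvalMz fvalM//; congr (_ *~ _).
rewrite -[LHS]/(pdo_seq P i p * iter _ (@Dx K) (pdo_seq Q j) p).
by rewrite (sP i p Op) (@iter_fDx K Omega oO _ (pdo_seq Y j))//; exact: sQ.
Qed.

Lemma rep_evol P X : rep P X ->
  rep (mapop (evol (@HS K)) P) (mapop (@fevol K Omega oO) X).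
Proof.
move=> [oP sP]; split=> // n p Op /=.
rewrite -[RHS]/(fval (fevol _) p) fval_fevol// !evol_vfield.
by apply: (vfield_congr oO) => // q Oq; exact: sP.
Qed.

Lemma represents_u k : represents (u k) (fu oO k).
Proof. by move=> p Op; rewrite fval_norm. Qed.

Lemma represents_nat n : represents n%:R n%:R.
Proof.
move=> p Op; rewrite fvalMn fval1//.
elim: n => // n IH; rewrite !mulrS.
by rewrite -[LHS]/(1 + (n%:R : jet K -> K) p) IH.
Qed.

Lemma represents_mul f g x y : represents f x -> represents g y ->
  represents (f * g) (x * y).
Proof.
by move=> fx gy p Op; rewrite fvalM// -[LHS]/(f p * g p) fx// gy.
Qed.

Lemma represents_exp f x n : represents f x -> represents (f ^+ n) (x ^+ n).
Proof.
move=> fx; elim: n => [|n IH] p Op; first by rewrite fval1.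
by rewrite !exprS; exact: represents_mul.
Qed.

Lemma represents_sub f g x y : represents f x -> represents g y ->
  represents (f - g) (x - y).
Proof.
by move=> fx gy p Op; rewrite fvalD fvalN -[LHS]/(f p - g p) fx// gy.
Qed.

Lemma rep_frechet : rep (frechet_HS K) (frechet (@fDx K Omega oO) (fu oO)).
Proof.
apply: rep_addop.
  apply: rep_addop; first apply: rep_compop; try exact: rep_powD;
    by apply/rep_mulop/represents_mul;
      [exact: represents_nat|exact: represents_u].
apply/rep_oppop/rep_scaleop/rep_compop; last exact: rep_powD.
apply: rep_compop; [exact: rep_powD|apply: rep_mulop; exact: represents_u].
Qed.

Lemma vanishes_lie R Z : rep R Z ->
  (forall m, coefD (lie (@fDx K Omega oO) (@fevol K Omega oO) (fu oO) Z) m = 0)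
    ->
  vanishes_on Omega (Lie_HS R).
Proof.
move=> rR lie0 m p Op.
have rL : rep (Lie_HS R) (lie (@fDx K Omega oO) (@fevol K Omega oO) (fu oO) Z).
  apply: rep_addop; last by apply: rep_compop => //; exact: rep_frechet.
  apply: rep_addop; first exact: rep_evol.
  by apply/rep_oppop/rep_compop => //; exact: rep_frechet.
by rewrite (rep_coef _ rL Op) lie0.
Qed.

(** Elements of [fring] may depend on w, so a representation in it does not show that the
    coefficients are differential functions; this is tracked on the operators themselves. *)
Definition all_nice P := forall n, nice false (pdo_seq P n).

Lemma all_nice_coef P m : all_nice P -> nice false (coefD P m).
Proof. by move=> nP; rewrite /coefD; case: ifP => _;
  [exact: nP|exact: nice_cst]. Qed.

Lemma is_pdo_nice P : all_nice P -> is_pdo Omega P.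
Proof. by move=> nP m; apply/differential_functionP/all_nice_coef. Qed.

Lemma nice_Mz f (n : int) : nice false f -> nice false (f *~ n).
Proof.
move=> nf; have nMn (k : nat) : nice false (f *+ k).
  by elim: k => [|k IH]; [exact: nice_cst|rewrite mulrS; exact: nice_add].
by case: n => n; rewrite ?NegzE ?mulrNz -?pmulrn;
  [exact: nMn|exact/nice_opp/nMn].
Qed.

Lemma all_nice_mulop f : nice false f -> all_nice (mulop f).
Proof. by move=> nf n /=; case: ifP => // _; exact: nice_cst. Qed.

Lemma all_nice_powD m : all_nice (powD _ m).
Proof. by move=> n /=; case: ifP => _; exact: nice_cst. Qed.

Lemma all_nice_addop P Q : all_nice P -> all_nice Q -> all_nice (addop P Q).
Proof. by move=> nP nQ n /=; apply: nice_add => //; exact: all_nice_coef. Qed.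

Lemma all_nice_oppop P : all_nice P -> all_nice (oppop P).
Proof. by move=> nP n /=; apply: nice_opp. Qed.

Lemma all_nice_scaleop c P : all_nice P -> all_nice (scaleop c P).
Proof. by move=> nP n /=; apply: nice_Mz. Qed.

Lemma all_nice_compop P Q : all_nice P -> all_nice Q ->
  all_nice (compop (@Dx K) P Q).
Proof.
move=> nP nQ n /=.
have nsum k (F : 'I_k -> jet K -> K) :
    (forall i, nice false (F i)) -> nice false (\sum_(i < k) F i).
  move=> nF; elim/big_ind: _ => // [|f g]; first exact: nice_cst.
  exact: nice_add.
apply: (nsum _ _) => i; apply: (nsum _ _) => j; apply/nice_Mz/nice_mul => //.
exact: nice_iterDx.
Qed.

End Transfer.

(* Dispatching on the head symbol avoids comparing the coefficient sequences
   of unrelated operators up to conversion. *)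
Ltac all_nice_tac := repeat lazymatch goal with
  | |- all_nice _ (addop _ _) => apply: all_nice_addop
  | |- all_nice _ (oppop _) => apply: all_nice_oppop
  | |- all_nice _ (scaleop _ _) => apply: all_nice_scaleop
  | |- all_nice _ (compop _ _ _) => apply: all_nice_compop
  | |- all_nice _ (mulop _) => apply: all_nice_mulop
  | |- all_nice _ (Dop _) => exact: all_nice_powD
  | |- all_nice _ (Dinv _) => exact: all_nice_powD
  | |- open _ => assumption
  end.

Ltac rep_tac := repeat lazymatch goal with
  | |- rep (addop _ _) _ => apply: rep_addop
  | |- rep (oppop _) _ => apply: rep_oppop
  | |- rep (scaleop _ _) _ => apply: rep_scaleop
  | |- rep (compop _ _ _) _ => apply: rep_compop
  | |- rep (mulop _) _ => apply: rep_mulop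
  | |- rep (Dop _) _ => exact: rep_powD
  | |- rep (Dinv _) _ => exact: rep_powD
  end.

(** * The three operators on the jet space *)

Theorem theorem3 (K : numFieldType) (Omega : set (jet K))
    (Omega_open : open Omega) :
  [/\ forall s : jet K -> K,
        differential_function Omega s ->
        (forall p, Omega p -> u 2 p != 0) ->
        (forall p, Omega p -> s p ^+ 2 = u 2 p) ->
        recursion_operator Omega (Re1 s),
      (forall p, Omega p -> u 2 p != 0) ->
        recursion_operator Omega (Re2 K)
    & (forall p, Omega p -> u 1 p != 0) ->
        recursion_operator Omega (Re3 K)].
Proof.
pose B := fring Omega_open; pose U := fu Omega_open.
pose DM := @fDxM K Omega Omega_open; pose EM := @fevolM K Omega Omega_open.
pose DU := @fDx_u K Omega Omega_open; pose EU1 := fevol_u1 Omega_open.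
pose EUS := fevol_uS Omega_open; pose tors := @fring_torsion K Omega Omega_open.
have repu := represents_u Omega_open.
have repD := @rep_powD K Omega Omega_open 1.
have repDi := @rep_powD K Omega Omega_open (-1).
have nu := nice_u Omega_open false.
have fu_inv k t : (forall p, Omega p -> u k p != 0) ->
    represents (recip (u k)) t -> U k * t = 1.
  move=> u0 rt; apply: fringP => p Op.
  by rewrite fvalM// fval1// -rt// fval_norm// mulfV ?u0.
have nX b f n : nice Omega b f -> nice Omega b (f ^+ n).
  by move=> nf; elim: n => [|n IH]; rewrite ?exprS;
    [exact: nice_cst|exact: nice_mul].
split=> [s /differential_functionP ns u0 su|u0|u0].
- have s0 p : Omega p -> s p != 0.
    by move=> Op; have := u0 p Op; rewrite -su// expf_eq0.
  have nrs := nice_recip Omega_open s0 ns.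
  pose fs : B := norm Omega_open (niceW ns);
    pose ft : B := norm Omega_open (niceW nrs).
  have reps : represents (recip s) ft by move=> p Op; rewrite fval_norm.
  (* The inverse of u_2 is represented as the square of that of [s], so that [s * t = 1] remains the
     only relation. *)
  have repr : represents (recip (u 2)) (ft ^+ 2).
    by move=> p Op; rewrite fvalX// fval_norm// /recip -su// exprVn.
  have reph : represents (u 3 * recip s ^+ 3) (U 3 * ft ^+ 3).
    by apply/represents_mul/represents_exp.
  split.
    apply: is_pdo_nice; rewrite /Re1 /=; all_nice_tac;
      first [exact: nice_recip|exact/nice_mul/nX].
  apply: (@vanishes_lie _ _ Omega_open _ (re1 (@fDx K Omega Omega_open) (ft ^+
    2) (U 3 * ft ^+ 3))).
    by rewrite /Re1 /re1 /=; rep_tac.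
  apply: (lie_re1 DM EM tors DU EU1 EUS (s := fs)).
    by apply: fringP => p Op; rewrite fvalM// !fval_norm// -expr2 su.
  by apply: fringP => p Op; rewrite fvalM// fval1// !fval_norm// mulfV ?s0.
- have nr := nice_recip Omega_open u0 (nu 2%N).
  pose t : B := norm Omega_open (niceW nr).
  have rept : represents (recip (u 2)) t by move=> p Op; rewrite fval_norm.
  split; first by apply: is_pdo_nice; rewrite /Re2 /=; all_nice_tac;
    first [exact/nice_mul/nX/nr/nX|exact: nu].
  apply: (@vanishes_lie _ _ Omega_open _
    (re2 (@fDx K Omega Omega_open) U (U 1 ^+ 4 * t ^+ 2))).
    rewrite /Re2 /re2 /=; rep_tac => //;
      exact/represents_mul/represents_exp/rept/represents_exp.
  exact: (lie_re2 DM EM DU EU1 EUS (fu_inv _ _ u0 rept)).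
- have nr := nice_recip Omega_open u0 (nu 1%N).
  pose t : B := norm Omega_open (niceW nr).
  have rept : represents (recip (u 1)) t by move=> p Op; rewrite fval_norm.
  pose g : jet K -> K := u 3 * recip (u 1) ^+ 6 - 3 * u 2 ^+ 2 * recip (u 1) ^+
    7.
  have ng : nice Omega false g.
    apply: nice_add => //; first exact/nice_mul/nX/nr/nu.
    apply: nice_opp => //; apply: nice_mul => //; last exact: nX.
    by apply: nice_mul => //; [exact: nice_nat|exact: nX].
  have repg : represents g (U 3 * t ^+ 6 - (U 2 ^+ 2 * t ^+ 7) *+ 3).
    rewrite (_ : _ - _ = U 3 * t ^+ 6 - 3%:R * U 2 ^+ 2 * t ^+ 7); last by ring.
    apply: represents_sub.
      by apply: represents_mul; [exact: repu|exact: represents_exp].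
    apply: represents_mul; last exact: represents_exp.
    by apply: represents_mul; [exact: represents_nat|exact: represents_exp].
  split; first by apply: is_pdo_nice; rewrite /Re3 /=; all_nice_tac;
    first [exact: nX|exact: nu|exact: ng].
  apply: (@vanishes_lie _ _ Omega_open _ (re3 (@fDx K Omega Omega_open) U (t ^+
    4)
    (U 3 * t ^+ 6 - (U 2 ^+ 2 * t ^+ 7) *+ 3))).
    by rewrite /Re3 /re3 /=; rep_tac;
      first [exact: represents_exp|exact: repu|exact: repg].
  exact: (lie_re3 DM EM DU EU1 EUS (fu_inv _ _ u0 rept)).
Qed.
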